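(* Let $\mathscr{P}$ be a finite ranked poset that has no antichain of size $3$. Then the order polytope $\mathcal{O}(\mathscr{P})$ is graphic, and therefore projectively unique.
   Context: A poset $\mathscr{P}=(X,\preceq)$ is ranked if there is a function $\rho:X\to\mathbb{N}$ with $\rho(y)=\rho(x)+1$ whenever $y$ covers $x$. The order polytope is $\mathcal{O}(\mathscr{P})=\{\mathbf t\in\mathbb{R}^X: 0\le t_i\le 1 \text{ for all } i\in X,\ t_i\le t_j \text{ whenever } i\preceq j\}$; it is full-dimensional. A full-dimensional polytope is projectively unique if every full-dimensional polytope combinatorially equivalent to it (same face lattice) is the image of it under a projective transformation. Graphicality: let $P\subseteq\mathbb{R}^d$ be a $d$-polytope with vertices $v_1,\dots,v_n$ and facets $F_1,\dots,F_m$, written $P=\{\mathbf t: h_i(\mathbf t)\ge 0,\ i=1,\dots,m\}$ with affine $h_i$ vanishing on $F_i$. The symbolic slack matrix $S_P(\mathbf x)$ is the $m\times n$ matrix obtained from $[h_i(v_j)]$ by replacing each nonzero entry (i.e. each pair with $v_j\notin F_i$) by a distinct variable; let $x_1,\dots,x_k$ be all these variables. The slack ideal is $I_P=\langle (d+2)\text{-minors of } S_P(\mathbf x)\rangle : (x_1\cdots x_k)^\infty\subseteq\mathbb{R}[\mathbf x]$. The non-incidence graph $\mathbf G_P$ is the bipartite graph on facets $\sqcup$ vertices with an edge $\{F,v\}$ iff $v\notin F$, labeled by the variable in position $(F,v)$ of $S_P(\mathbf x)$. For a cycle $C$ of $\mathbf G_P$ oriented as a directed cycle, $f_C$ is the product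 of the labels of edges oriented from a facet to a vertex minus the product of the labels of edges oriented from a vertex to a facet (defined up to sign). $T_P\subseteq\mathbb{R}[\mathbf x]$ is the ideal generated by $f_C$ for all chordless cycles $C$ of $\mathbf G_P$. $P$ is graphic if $I_P=T_P$ (this depends only on the combinatorial type of $P$). *)

(* Defs.v *)
From mathcomp Require Import all_boot all_order all_algebra.
From mathcomp Require Import mpoly.
From mathcomp Require Import classical_sets reals.

Set Implicit Arguments.
Unset Strict Implicit.
Unset Printing Implicit Defensive.

Import Order.TTheory GRing.Theory Num.Theory.

Local Open Scope classical_set_scope.
Local Open Scope ring_scope.

(** * Posets and order polytopes *)

(* y covers x. *)
Definition covered_by (disp : Order.disp_t) (X : finPOrderType disp) (x y : X) :=
  (x < y)%O /\ ~ exists z : X, (x < z)%O /\ (z < y)%O.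

Definition ranked (disp : Order.disp_t) (X : finPOrderType disp) :=
  exists rho : X -> nat, forall x y, covered_by x y -> rho y = (rho x).+1.

Definition antichain (disp : Order.disp_t) (X : finPOrderType disp)
    (A : {set X}) :=
  forall x y, x \in A -> y \in A -> (x <= y)%O -> x = y.

(* R^X is 'rV[R]_#|X|, the coordinate of t at x being t 0 (enum_rank x). *)
Definition order_polytope (R : realType) (disp : Order.disp_t)
    (X : finPOrderType disp) : set 'rV[R]_#|X| :=
  [set t : 'rV[R]_#|X| |
     (forall i : X, 0 <= t 0 (enum_rank i) <= 1)
     /\ (forall i j : X, (i <= j)%O ->
           t 0 (enum_rank i) <= t 0 (enum_rank j))].
Arguments order_polytope R {disp} X.

(** * Polytopes, faces, combinatorial equivalence *)

Definition is_polytope (R : realType) (d : nat) (P : set 'rV[R]_d) :=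
  exists (n : nat) (V : 'M[R]_(n, d)),
    P = [set x : 'rV[R]_d | exists w : 'rV[R]_n,
           [/\ forall i, 0 <= w 0 i, \sum_i w 0 i = 1 & x = w *m V]].

(* The homogenization (1, x) of a point x. *)
Definition hpoint (R : realType) (d : nat) (x : 'rV[R]_d) : 'rV[R]_(1 + d) :=
  row_mx 1%:M x.

(* A column vector c = (c_0, c') stands for the affine function
   x |-> c_0 + x . c'. *)
Definition aff (R : realType) (d : nat) (c : 'cV[R]_(1 + d)) (x : 'rV[R]_d) : R
  := (hpoint x *m c) 0 0.

(* affine_rank S r means dim S = r - 1 (with dim set0 = -1): r is the largest
   size of an affinely independent family of points of S, affine independence
   being linear independence of the homogenizations. *)
Definition affine_rank (R : realType) (d : nat) (S : set 'rV[R]_d) (r : nat) :=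
  (exists A : 'M[R]_(r, d), (forall i, S (row i A))
      /\ row_free (\matrix_i hpoint (row i A)))
  /\ (forall (s : nat) (A : 'M[R]_(s, d)), (forall i, S (row i A)) ->
        row_free (\matrix_i hpoint (row i A)) -> (s <= r)%N).

Definition full_dimensional (R : realType) (d : nat) (P : set 'rV[R]_d) :=
  affine_rank P d.+1.

(* Both set0 and P are faces of P (c = 1 and c = 0). *)
Definition is_face (R : realType) (d : nat) (P F : set 'rV[R]_d) :=
  exists c : 'cV[R]_(1 + d),
    (forall x, P x -> 0 <= aff c x) /\ F = [set x | P x /\ aff c x = 0].

(* Facets of a polytope that is full-dimensional in R^d: faces of
   dimension d - 1. *)
Definition is_facet (R : realType) (d : nat) (P F : set 'rV[R]_d) :=
  is_face P F /\ affine_rank F d.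

Definition is_vertex (R : realType) (d : nat) (P : set 'rV[R]_d)
    (v : 'rV[R]_d) :=
  is_face P [set v].

(* An isomorphism of the face lattices, ordered by inclusion; injectivity
   follows from the last clause. *)
Definition comb_equiv (R : realType) (d : nat) (P Q : set 'rV[R]_d) :=
  exists phi : set 'rV[R]_d -> set 'rV[R]_d,
    [/\ forall F, is_face P F -> is_face Q (phi F),
        forall G, is_face Q G -> exists2 F, is_face P F & phi F = G
      & forall F F', is_face P F -> is_face P F' ->
          (F `<=` F' <-> phi F `<=` phi F')].

(** * Projective transformations *)

Definition proj_denom (R : realType) (d : nat) (M : 'M[R]_(1 + d))
    (x : 'rV[R]_d) : R := lsubmx (hpoint x *m M) 0 0.

Definition proj_map (R : realType) (d : nat) (M : 'M[R]_(1 + d))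
    (x : 'rV[R]_d) : 'rV[R]_d := (proj_denom M x)^-1 *: rsubmx (hpoint x *m M).

(* The denominator must not vanish on P, i.e. no point of P is sent to the
   hyperplane at infinity. *)
Definition proj_equiv (R : realType) (d : nat) (P Q : set 'rV[R]_d) :=
  exists2 M : 'M[R]_(1 + d), M \in unitmx
    & (forall x, P x -> proj_denom M x != 0) /\ Q = proj_map M @` P.

Definition projectively_unique (R : realType) (d : nat) (P : set 'rV[R]_d) :=
  forall Q : set 'rV[R]_d,
    is_polytope Q -> full_dimensional Q -> comb_equiv P Q -> proj_equiv P Q.

(** * Ideals of a commutative ring *)

Definition ideal_gen (A : comNzRingType) (G : set A) : set A :=
  [set p | exists2 s : seq (A * A), (forall u, u \in s -> G u.2)
      & p = \sum_(u <- s) u.1 * u.2].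

Definition saturation (A : comNzRingType) (I : set A) (a : A) : set A :=
  [set p | exists N : nat, I (a ^+ N * p)].

(** * Slack matrices *)

(* h and v list, without repetition, facet-defining affine functions (one for
   each facet) and the vertices of P. *)
Definition facets_vertices (R : realType) (d m n : nat) (P : set 'rV[R]_d)
    (h : 'I_m -> 'cV[R]_(1 + d)) (v : 'I_n -> 'rV[R]_d) :=
  let F i := [set x | P x /\ aff (h i) x = 0] in
  [/\ P = [set x | forall i, 0 <= aff (h i) x],
      (injective F /\ forall G, is_facet P G <-> exists i, G = F i)
    & (injective v /\ forall x, is_vertex P x <-> exists j, x = v j)].

Definition slack_matrix (R : realType) (d m n : nat)
    (h : 'I_m -> 'cV[R]_(1 + d)) (v : 'I_n -> 'rV[R]_d) : 'M[R]_(m, n) :=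
  \matrix_(i, j) aff (h i) (v j).

Definition support_mx (R : realType) (m n : nat) (S : 'M[R]_(m, n)) :
    {set 'I_m * 'I_n} := [set p | S p.1 p.2 != 0].

(* The number k of variables. *)
Notation nvars S := #|support_mx S|.

(* The t-th variable sits at the t-th position of the support of S. *)
Definition symbolic (R : realType) (m n : nat) (S : 'M[R]_(m, n)) :
    'M[{mpoly R[nvars S]}]_(m, n) :=
  \matrix_(i, j)
    if [pick t : 'I_(nvars S) | enum_val t == (i, j)] is Some t
    then 'X_t else 0.

Definition is_minor (A : comNzRingType) (m n k : nat) (M : 'M[A]_(m, n))
    (p : A) :=
  exists (f : 'I_k -> 'I_m) (g : 'I_k -> 'I_n),
    [/\ {homo f : a b / (a < b)%N}, {homo g : a b / (a < b)%N}
      & p = \det (mxsub f g M)].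

Definition slack_ideal (R : realType) (d m n : nat) (S : 'M[R]_(m, n)) :
    set {mpoly R[nvars S]} :=
  saturation (ideal_gen [set p | is_minor d.+2 (symbolic S) p])
             (\prod_(t < nvars S) 'X_t).
Arguments slack_ideal {R} d {m n} S.

(** * The non-incidence graph and its cycle ideal *)

(* Nodes: inl i is the facet (row) i, inr j is the vertex (column) j. *)
Definition nonincidence (R : realType) (m n : nat) (S : 'M[R]_(m, n)) :
    rel ('I_m + 'I_n) :=
  fun a b => match a, b with
             | inl i, inr j | inr j, inl i => S i j != 0
             | _, _ => false
             end.

Definition edge_label (R : realType) (m n : nat) (S : 'M[R]_(m, n))
    (a b : 'I_m + 'I_n) : {mpoly R[nvars S]} :=
  match a, b with
  | inl i, inr j | inr j, inl i => symbolic S i j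
  | _, _ => 0
  end.

Definition chordless_cycle (V : eqType) (e : rel V) (c : seq V) :=
  [/\ (2 < size c)%N, ucycle e c
    & forall a b, a \in c -> b \in c -> e a b ->
        b = next c a \/ a = next c b].

Definition is_row (m n : nat) (a : 'I_m + 'I_n) :=
  if a is inl _ then true else false.

Definition cycle_binomial (R : realType) (m n : nat) (S : 'M[R]_(m, n))
    (c : seq ('I_m + 'I_n)) : {mpoly R[nvars S]} :=
  \prod_(a <- c | is_row a) edge_label S a (next c a)
  - \prod_(a <- c | ~~ is_row a) edge_label S a (next c a).

Definition cycle_ideal (R : realType) (m n : nat) (S : 'M[R]_(m, n)) :
    set {mpoly R[nvars S]} :=
  ideal_gen [set p | exists2 c, chordless_cycle (nonincidence S) c
                       & p = cycle_binomial S c].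
Arguments cycle_ideal {R m n} S.

(* For a full-dimensional polytope P, two choices of h and v differ by the
   order of facets and vertices and by positive rescaling of the h i, which
   only renames the variables. *)
Definition graphic (R : realType) (d : nat) (P : set 'rV[R]_d) :=
  exists (m n : nat) (h : 'I_m -> 'cV[R]_(1 + d)) (v : 'I_n -> 'rV[R]_d),
    facets_vertices P h v
    /\ slack_ideal d (slack_matrix h v) = cycle_ideal (slack_matrix h v).

(* Main.v *)
(* In coordinates indexed by the edges (facets) of the Hasse diagram of X with a
   bottom and a top added and by the filters (vertices), the slack matrix is the
   0/1 matrix telling which filters cut which edges. The key fact, valid over
   every commutative ring, is that a matrix with invertible entries on this
   support, zeros elsewhere and vanishing minors of size #|X| + 2 is of the form
   r_e t_J on its support. It is proved by removing a maximal element m: the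
   facet t_m = 1 is the order polytope of X minus m, and as the width is 2, the
   filters avoiding m form a single chain.

   Over the reals the key fact gives projective uniqueness, since a
   combinatorially equivalent polytope has a slack matrix with the same support.
   Over the Laurent polynomial ring modulo the minors it shows that all cycle
   binomials lie in the slack ideal. Conversely, the minors vanish under the
   substitution x_ij = r_i t_j, whose kernel is generated by the binomials of
   closed walks; a chord splits a closed walk into two shorter ones, so chordless
   cycles suffice. *)
Require Import Defs.
From HB Require Import structures.
From mathcomp Require Import all_boot all_order all_algebra.
From mathcomp Require Import perm mpoly reals.
From mathcomp Require Import ring lra zify.
From mathcomp Require boolp classical_sets.

Set Implicit Arguments.
Unset Strict Implicit.
Unset Printing Implicit Defensive.

Import Order.TTheory GRing.Theory Num.Theory.

Local Open Scope ring_scope.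

(** * Edges of the Hasse diagram and filters *)

(** The quotient ring in the key fact may have zero divisors, so the factorization replaces rank by
    the statement that every column is a combination of the columns of one maximal flag of filters,
    on which some minor is triangular with unit diagonal. The induction makes the columns of the
    filters containing m into 0/1 columns on the facets inherited from the rest. It says nothing
    about the filters avoiding m, nor about a facet (a, m) with a a lower cover of m that is not
    maximal in the rest. Such a facet is an affine function of the filter and, when a is not in the
    filter, sees only the part above a, which avoids m; it may carry a factor depending on that
    part. If no lower cover of m is maximal in the rest, rank and width force all lower covers of m
    to have the same elements of the rest above them, so one factor serves all these facets. It can
    be absorbed into rows and columns, because a filter cutting an edge (a, b) of the rest meets
    this common chain exactly in the elements above or equal to b. *)

Section Edges.
Context {disp : Order.disp_t} {X : finPOrderType disp}.
Implicit Types (Y J K : {set X}) (a b : option X) (x y z : X).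

(* The facets of the order polytope of the subposet Y are the edges (a, b) of
   the Hasse diagram of Y with a bottom and a top added: as a first component
   None is the bottom, as a second component it is the top. The vertices are
   the filters J of Y, and the facet t_a <= t_b misses the vertex J if and only
   if J cuts (a, b). *)
Definition olt a b :=
  match a, b with Some x, Some y => (x < y)%O | _, _ => true end.

Definition oin Y a := if a is Some x then x \in Y else true.

Definition inlo J a := if a is Some x then x \in J else false.

Definition edge Y a b :=
  [&& oin Y a, oin Y b, olt a b
    & [forall z in Y, ~~ (olt a (Some z) && olt (Some z) b)]].

Definition cuts J a b := ~~ inlo J a && oin J b.

Definition upset Y J :=
  (J \subset Y) && [forall x in J, forall y in Y, (x <= y)%O ==> (y \in J)].

Lemma upsetP Y J :
  reflect (J \subset Y /\ forall x y, x \in J -> y \in Y -> (x <= y)%O -> y \in J)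
          (upset Y J).
Proof.
apply: (iffP andP) => -[sJ H]; split=> //.
  by move=> x y xJ yY; move/forall_inP: H => /(_ x xJ)/forall_inP/(_ y yY)/implyP.
apply/forall_inP => x xJ; apply/forall_inP => y yY; apply/implyP; exact: H.
Qed.

Lemma edgeP Y a b :
  reflect [/\ oin Y a, oin Y b, olt a b
            & forall z, z \in Y -> olt a (Some z) -> olt (Some z) b -> False]
          (edge Y a b).
Proof.
apply: (iffP and4P) => -[h1 h2 h3 h4]; split=> //.
  by move=> z zY az zb; move/forall_inP: h4 => /(_ z zY); rewrite az zb.
by apply/forall_inP => z zY; apply/negP => /andP[]; apply: h4.
Qed.

(** The number of elements strictly below is the measure used for inductions and for choosing
    extremal elements. *)
Lemma card_below x y : (x < y)%O ->
  (#|[set w | (w < x)%O]| < #|[set w : X | (w < y)%O]|)%N.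
Proof.
move=> xy; apply: proper_card; apply/properP; split.
  by apply/subsetP => w; rewrite !inE => /lt_trans; apply.
by exists x; rewrite !inE ?ltxx.
Qed.

(** [None] is the bottom on the left and the top on the right, so transitivity fails through it. *)
Lemma olt_trans b a c : (b != None) -> olt a b -> olt b c -> olt a c.
Proof. by case: a b c => [x|] [y|] [z|] //= _; apply: lt_trans. Qed.

Lemma edge_up Y a y : oin Y a -> y \in Y -> olt a (Some y) ->
  exists2 c, edge Y a (Some c) & (c <= y)%O.
Proof.
move=> aY yY ay.
have P0 : [&& y \in Y, olt a (Some y) & (y <= y)%O] by rewrite yY ay lexx.
case: (@arg_minnP _ y (fun c => [&& c \in Y, olt a (Some c) & (c <= y)%O])
        (fun c => #|[set w : X | (w < c)%O]|) P0) => c /and3P[cY ac cy] H.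
exists c => //; apply/edgeP; split=> // z zY az zc.
suff /H : [&& z \in Y, olt a (Some z) & (z <= y)%O] by rewrite /= leqNgt card_below.
by rewrite zY az (le_trans (ltW zc) cy).
Qed.

Lemma edge_down Y b x : oin Y b -> x \in Y -> olt (Some x) b ->
  exists2 c, edge Y (Some c) b & (x <= c)%O.
Proof.
move=> bY xY xb.
have P0 : [&& x \in Y, olt (Some x) b & (x <= x)%O] by rewrite xY xb lexx.
case: (@arg_maxnP _ x (fun c => [&& c \in Y, olt (Some c) b & (x <= c)%O])
        (fun c => #|[set w : X | (w < c)%O]|) P0) => c /and3P[cY cb xc] H.
exists c => //; apply/edgeP; split=> // z zY cz zb.
suff /H : [&& z \in Y, olt (Some z) b & (x <= z)%O] by rewrite /= leqNgt card_below.
by rewrite zY zb (le_trans xc (ltW cz)).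
Qed.

Lemma edge_into Y y : y \in Y -> exists a, edge Y a (Some y).
Proof.
move=> yY; case: (boolP [exists x in Y, (x < y)%O]) => [/exists_inP[x xY xy]|].
  by have [c ? _] := edge_down (b := Some y) yY xY xy; exists (Some c).
move/exists_inP => H; exists None; apply/edgeP; split=> // z zY _ /= zy.
by apply: H; exists z.
Qed.

Lemma edge_from Y x : x \in Y -> exists b, edge Y (Some x) b.
Proof.
move=> xY; case: (boolP [exists y in Y, (x < y)%O]) => [/exists_inP[y yY xy]|].
  by have [c ? _] := edge_up (a := Some x) xY yY xy; exists (Some c).
move/exists_inP => H; exists None; apply/edgeP; split=> // z zY /= zy _.
by apply: H; exists z.
Qed.

Lemma edge_top Y : exists a, edge Y a None.
Proof.
case: (set_0Vmem Y) => [->|[x xY]].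
  by exists None; apply/edgeP; split=> // z; rewrite inE.
by have [c ? _] := @edge_down Y None x isT xY isT; exists (Some c).
Qed.

Lemma inlo_in Y J a b : upset Y J -> edge Y a b -> inlo J a -> oin J b.
Proof.
case/upsetP => sJ H /edgeP[]; case: a b => [x|] [y|] //= _ yY xy _ xJ.
exact: H xJ yY (ltW xy).
Qed.

(** A filter containing a contains b, so a cut is the gradient along the edge of the membership
    function, taken as 0 at the bottom and 1 at the top. *)
Lemma cutsE (A : pzRingType) Y J a b : upset Y J -> edge Y a b ->
  (cuts J a b)%:R = (oin J b)%:R - (inlo J a)%:R :> A.
Proof.
move=> uJ eab; rewrite /cuts; have := inlo_in uJ eab.
by case: (inlo J a) (oin J b) => [] [] //= h; rewrite ?subrr ?subr0 //; case: (h isT).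
Qed.

(* The least and the greatest filter cutting an edge (a, b). *)
Definition above b := if b is Some y then [set z : X | (y <= z)%O] else set0.
Definition not_below a := if a is Some x then [set z : X | ~~ (z <= x)%O] else [set: X].

Lemma upset_above b : upset [set: X] (above b).
Proof.
apply/upsetP; split=> [|x z]; first exact: subsetT.
by rewrite /above; case: b => [y|]; rewrite !inE // => yx _; apply: le_trans yx.
Qed.

Lemma upset_not_below a : upset [set: X] (not_below a).
Proof.
apply/upsetP; split=> [|x z]; first exact: subsetT.
rewrite /not_below; case: a => [y|]; rewrite !inE // => yx _ xz.
by apply: contra yx; apply: le_trans.
Qed.

Lemma cuts_above Y a b : edge Y a b -> cuts (above b) a b.
Proof.
rewrite /cuts /above => /edgeP[_ _ + _]; case: a b => [x|] [y|] //=; rewrite ?inE ?lexx ?andbT //.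
by rewrite lt_leAnge => /andP[].
Qed.

Lemma cuts_not_below Y a b : edge Y a b -> cuts (not_below a) a b.
Proof.
rewrite /cuts /not_below => /edgeP[_ _ + _]; case: a b => [x|] [y|] //=; rewrite ?inE ?lexx ?andbT //.
by rewrite lt_leAnge => /andP[].
Qed.

Section Potential.
Variable A : zmodType.
Definition lo (u : X -> A) a := if a is Some x then u x else 0.
Definition hi (U : A) (u : X -> A) b := if b is Some y then u y else U.

(** Walking down edges of zero gradient from y stays outside J and ends at the bottom, where the
    value is 0. *)
Lemma potential_bot Y J (u : X -> A) : upset Y J ->
  (forall a y, edge Y a (Some y) -> y \notin J -> lo u a = u y) ->
  forall y, y \in Y -> y \notin J -> u y = 0.
Proof.
move=> /upsetP[sJ uJ] H y; have [n] := ubnP #|[set w : X | (w < y)%O]|.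
elim: n y => // n IH y; rewrite ltnS => le_n yY yJ.
have [a ea] := edge_into yY; rewrite -(H _ _ ea yJ).
case/edgeP: ea; case: a => [x|] //= xY _ xy _.
apply: IH => //; first exact: leq_trans (card_below xy) le_n.
by apply: contra yJ => /uJ; apply=> //; apply: ltW.
Qed.

(** Dually, walking up from x stays in J and ends at the top, where the value is U. *)
Lemma potential_top Y J (U : A) (u : X -> A) : upset Y J ->
  (forall x b, edge Y (Some x) b -> x \in J -> hi U u b = u x) ->
  forall x, x \in J -> u x = U.
Proof.
move=> /upsetP[/subsetP sJ uJ] H x.
have [n] := ubnP (#|X| - #|[set w : X | (w < x)%O]|).
elim: n x => // n IH x; rewrite ltnS => le_n xJ.
have [b eb] := edge_from (sJ _ xJ); rewrite -(H _ _ eb xJ).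
case/edgeP: eb; case: b => [y|] //= xY yY xy _.
apply: IH; last exact: uJ xJ yY (ltW xy).
apply: leq_trans le_n; apply: ltn_sub2l (card_below xy).
exact: leq_trans (card_below xy) (max_card _).
Qed.

End Potential.

End Edges.

(** * Maximal flags of filters *)

Section Flags.
Context {disp : Order.disp_t} {X : finPOrderType disp}.
Implicit Types (s : seq X) (J K : {set X}) (a b : option X) (x y z m : X).

(* Reversed linear extensions of the subposet s. *)
Definition revext s := uniq s && pairwise (fun x y => ~~ (x < y)%O) s.

(** A maximal chain of filters. The recursion follows the removal of the maximal element m: the
    members containing m come from the flag of the rest. *)
Fixpoint flag s : seq {set X} :=
  if s is m :: s' then set0 :: [seq m |: K | K <- flag s'] else [:: set0].

Lemma revext_cons m s : revext (m :: s) ->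
  [/\ m \notin s, forall z, z \in s -> ~~ (m < z)%O & revext s].
Proof. by case/andP=> /= /andP[-> us] /andP[/allP H ps]; split=> //; apply/andP. Qed.

Lemma upset_cons m s K : revext (m :: s) -> upset [set x in s] K ->
  upset [set x in m :: s] (m |: K).
Proof.
case/revext_cons=> ms mmax _ /upsetP[/subsetP sK uK]; apply/upsetP; split.
  by apply/subsetP=> x; rewrite !inE => /orP[->//|/sK]; rewrite inE => ->; rewrite orbT.
move=> x y; rewrite !inE => /orP[/eqP->|xK] /orP[/eqP->|ys] xy; rewrite ?eqxx //.
  by move: (mmax _ ys); rewrite lt_neqAle xy andbT negbK => /eqP <-; rewrite eqxx.
by rewrite (uK x y) ?inE ?orbT.
Qed.

Lemma flag_upset s K : revext s -> K \in flag s -> upset [set x in s] K.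
Proof.
elim: s K => [|m s IH] K rs /=.
  rewrite inE => /eqP->; apply/upsetP; split; first exact: sub0set.
  by move=> x y; rewrite inE.
rewrite inE => /orP[/eqP->|/mapP[L /IH uL ->]].
  by apply/upsetP; split=> [|x y]; rewrite ?sub0set ?inE.
by apply: upset_cons (uL _) => //; case/revext_cons: rs.
Qed.

(** The filters of a flag are the vertices of a unimodular simplex, so affine interpolation of
    arbitrary values works over any ring. *)
Lemma flag_affine (A : nzRingType) s (f : {set X} -> A) : uniq s ->
  exists f0 (fz : X -> A), forall K, K \in flag s ->
    f K = f0 + \sum_(z <- s) fz z * (z \in K)%:R.
Proof.
elim: s f => [|m s IH] f /=.
  by move=> _; exists (f set0), (fun=> 0) => K; rewrite inE => /eqP->; rewrite big_nil addr0.
case/andP=> ms /(IH (fun K => f (m |: K)))[f0 [fz H]].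
exists (f set0), (fun z => if z == m then f0 - f set0 else fz z) => K.
have E (L : {set X}) : \sum_(z <- s) (if z == m then f0 - f set0 else fz z) * (z \in L)%:R =
    \sum_(z <- s) fz z * (z \in L)%:R.
  by apply: eq_big_seq => z zs; case: eqP => // zm; rewrite -zm zs in ms.
rewrite big_cons eqxx E inE => /orP[/eqP->|/mapP[L /H fL ->]].
  by rewrite inE mulr0 add0r big1 ?addr0 // => z _; rewrite inE mulr0.
rewrite fL !inE eqxx mulr1 addrA [f set0 + _]addrC subrK; congr (_ + _).
apply: eq_big_seq => z zs; rewrite !inE; case: eqP => // zm; by rewrite -zm zs in ms.
Qed.

Definition supported (A : unitRingType) Y (M : option X -> option X -> {set X} -> A) :=
  forall a b J, edge Y a b -> upset Y J ->
    if cuts J a b then M a b J \is a GRing.unit else M a b J == 0.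

(* With A a field and s an enumeration of Y, this says that M has rank at
   most #|Y| + 1, the flag columns being independent. *)
Definition flag_spanned (A : nzRingType) s (M : option X -> option X -> {set X} -> A) :=
  forall J, upset [set x in s] J -> exists c : {set X} -> A,
    forall a b, edge [set x in s] a b ->
      M a b J = \sum_(K <- flag s) c K * M a b K.

End Flags.

(** * Removing a maximal element *)

Section Step.
Context {disp : Order.disp_t} {X : finPOrderType disp} {A : comUnitRingType}.
Implicit Types (J K L : {set X}) (a b : option X) (x y z : X).
Variables (m : X) (s : seq X).
Hypothesis rs : revext (m :: s).
Let Y := [set x in m :: s].
Let Y' := [set x in s].

Let rs' : revext s. Proof. by case/revext_cons: rs. Qed.
Let ms : m \notin s. Proof. by case/revext_cons: rs. Qed.
Let mmax z : z \in s -> ~~ (m < z)%O. Proof. by case/revext_cons: rs => _ H _; apply: H. Qed.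

Lemma edge_m b : edge Y (Some m) b -> b = None.
Proof.
case/edgeP; case: b => [y|] //= _; rewrite !inE => /orP[/eqP->|ys] my _.
  by rewrite ltxx in my.
by have := mmax ys; rewrite my.
Qed.

(* When m is removed the facet t_m = 1 has the facets t_x <= t_m, x maximal
   in Y', which play the role of t_x <= 1; bs maps a facet (a, b) of the small
   polytope to the facet of the big one. *)
Definition bs a b :=
  if b is Some y then Some y else if edge Y a None then None else Some m.

Lemma edge_bs a b : edge Y' a b -> edge Y a (bs a b).
Proof.
case/edgeP=> aY bY ab H.
have aYY : oin Y a by move: aY; case: (a) => //= x; rewrite !inE => ->; rewrite orbT.
case: b bY ab H => [y|] /=.
  rewrite !inE => ys ab H; apply/edgeP; split=> //=; first by rewrite !inE ys orbT.
  move=> z; rewrite !inE => /orP[/eqP->|zs] az zy; last by apply: (H z); rewrite ?inE.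
  by have := mmax ys; rewrite zy.
move=> _ _ H; case: ifP => // /negP na; apply/edgeP; split=> //=.
- by rewrite !inE eqxx.
- case: a aY {aYY} H na => //= x; rewrite inE => xs H na.
  apply/negPn/negP => nxm; apply: na; apply/edgeP; split=> //=.
    by rewrite !inE xs orbT.
  move=> z; rewrite !inE => /orP[/eqP-> xm|zs xz] _; first by rewrite xm in nxm.
  by apply: (H z); rewrite ?inE.
- move=> z; rewrite !inE => /orP[/eqP->|zs] az /=; rewrite ?ltxx // => _.
  by apply: (H z); rewrite ?inE.
Qed.

Lemma edge_bs_inv a b : edge Y a b -> b <> Some m -> a <> Some m ->
  edge Y' a b /\ bs a b = b.
Proof.
move=> eab bm am; split; last by case: b eab {bm} => //= ->.
case/edgeP: eab => aY bY ab H; apply/edgeP; split=> //.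
- by case: a aY am {ab H} => //= x; rewrite !inE => /orP[/eqP->|].
- by case: b bY bm {ab H} => //= x; rewrite !inE => /orP[/eqP->|].
- by move=> z; rewrite inE => zs; apply: H; rewrite !inE zs orbT.
Qed.

Lemma notin_m K : upset Y' K -> m \notin K.
Proof. by case/upsetP=> /subsetP sK _; apply/negP => /sK; rewrite inE (negPf ms). Qed.

Lemma cuts_bs a b K : edge Y' a b -> cuts (m |: K) a (bs a b) = cuts K a b.
Proof.
case/edgeP=> aY bY _ _; rewrite /cuts.
have -> : inlo (m |: K) a = inlo K a.
  by case: a aY => //= x; rewrite !inE; case: eqP => // -> h; rewrite (negPf ms) in h.
congr (_ && _); case: b bY => [y|] /=; last by case: ifP => //=; rewrite !inE eqxx.
by rewrite !inE; case: eqP => // -> h; rewrite (negPf ms) in h.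
Qed.

Lemma upset_m J : upset Y J -> m \notin J -> upset Y' J.
Proof.
case/upsetP=> /subsetP sJ uJ mJ; apply/upsetP; split=> [|x y xJ].
  apply/subsetP=> x xJ; move: (sJ _ xJ); rewrite !inE => /orP[/eqP xm|//].
  by rewrite -xm xJ in mJ.
by rewrite inE => ys; apply: uJ; rewrite // !inE ys orbT.
Qed.

Lemma upset_mD J : upset Y J -> upset Y' (J :\ m).
Proof.
case/upsetP=> /subsetP sJ uJ; apply/upsetP; split=> [|x y].
  apply/subsetP=> x; rewrite !inE => /andP[xm /sJ]; by rewrite !inE (negPf xm).
rewrite !inE => /andP[xm xJ] ys xy; rewrite (uJ x y) ?inE ?ys ?orbT // andbT.
by apply: contra ms => /eqP <-.
Qed.

Lemma upset_below J z : upset Y J -> m \notin J -> z \in J -> ~~ (z < m)%O.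
Proof.
case/upsetP=> /subsetP sJ uJ mJ zJ; apply: contra mJ => zm.
by apply: uJ zJ _ (ltW zm); rewrite !inE eqxx.
Qed.

Variable M : option X -> option X -> {set X} -> A.
Hypothesis suppM : supported Y M.
Hypothesis spanM : flag_spanned (m :: s) M.

Lemma M_unit a b J : edge Y a b -> upset Y J -> cuts J a b -> M a b J \is a GRing.unit.
Proof. by move=> e u c; have := suppM e u; rewrite c. Qed.

Lemma M_zero a b J : edge Y a b -> upset Y J -> ~~ cuts J a b -> M a b J = 0.
Proof. by move=> e u /negPf c; have := suppM e u; rewrite c => /eqP. Qed.

Let upset0 (B : {set X}) : upset B set0.
Proof. by apply/upsetP; split=> [|x y]; rewrite ?sub0set ?inE. Qed.

Let edge_mN : edge Y (Some m) None.
Proof.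
apply/edgeP; split=> //=; first by rewrite !inE eqxx.
move=> z; rewrite !inE => /orP[/eqP->|zs] mz _; first by rewrite ltxx in mz.
by have := mmax zs; rewrite mz.
Qed.

Lemma span_big J (c : {set X} -> A) a b :
  \sum_(K <- flag (m :: s)) c K * M a b K =
  c set0 * M a b set0 + \sum_(K <- flag s) c (m |: K) * M a b (m |: K).
Proof. by rewrite /= big_cons big_map. Qed.

(** The facet (m, top) vanishes on every filter containing m, and among the flag columns only that
    of the empty filter is nonzero on it. *)
Lemma span_top J c : upset Y J -> m \in J ->
  (forall a b, edge Y a b -> M a b J = \sum_(K <- flag (m :: s)) c K * M a b K) ->
  c set0 = 0.
Proof.
move=> uJ mJ /(_ _ _ edge_mN); rewrite span_big //.
rewrite M_zero //; last by rewrite /cuts /= mJ.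
rewrite big_seq big1 ?addr0 => [/esym/eqP|K KF].
  have u : M (Some m) None set0 \is a GRing.unit by apply: M_unit; rewrite // /cuts /= inE.
  by rewrite mulrC (mulrI_eq0 _ (mulrI u)) => /eqP.
rewrite M_zero ?mulr0 //; first exact/upset_cons/flag_upset.
by rewrite /cuts /= !inE eqxx.
Qed.

Lemma supported_tail : supported Y' (fun a b K => M a (bs a b) (m |: K)).
Proof.
move=> a b K e u; have := suppM (edge_bs e) (upset_cons rs u).
by rewrite cuts_bs.
Qed.

Lemma flag_spanned_tail : flag_spanned s (fun a b K => M a (bs a b) (m |: K)).
Proof.
move=> K uK; have uJ := upset_cons rs uK; have [c H] := spanM uJ.
exists (fun L => c (m |: L)) => a b e; rewrite (H _ _ (edge_bs e)) span_big //.
by rewrite (span_top uJ _ H) ?mul0r ?add0r // !inE eqxx.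
Qed.

(** What the induction provides on the facet t_m = 1 once rows and columns are rescaled by units. *)
Hypothesis norm : forall a b K, edge Y' a b -> upset Y' K ->
  M a (bs a b) (m |: K) = (cuts K a b)%:R.
(** As m is maximal, these elements are incomparable to m, so this is the width condition. *)
Hypothesis chain : forall y z, y \in s -> z \in s ->
  ~~ (y < m)%O -> ~~ (z < m)%O -> (y <= z)%O || (z <= y)%O.

(** For an expansion c of a column in the flag, [pot c], with value 0 at the bottom and [tot c] at
    the top, is a potential whose gradient along the edges of the rest is the contribution of the
    flag members containing m. *)
Let pot (c : {set X} -> A) z := \sum_(K <- flag s) c (m |: K) * (z \in K)%:R.
Let tot (c : {set X} -> A) := \sum_(K <- flag s) c (m |: K).

Let spans c J := forall a b, edge Y a b ->
  M a b J = \sum_(K <- flag (m :: s)) c K * M a b K.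

Lemma col_eq c J a b : spans c J -> edge Y' a b ->
  M a (bs a b) J =
  c set0 * M a (bs a b) set0 + hi (tot c) (pot c) b - lo (pot c) a.
Proof.
move=> H e; rewrite (H _ _ (edge_bs e)) span_big // -addrA; congr (_ + _).
rewrite (_ : hi _ _ b = \sum_(K <- flag s) c (m |: K) * (oin K b)%:R); last first.
  by case: (b) => //=; apply: eq_bigr => K _; rewrite mulr1.
rewrite (_ : lo _ a = \sum_(K <- flag s) c (m |: K) * (inlo K a)%:R); last first.
  by case: (a) => //=; rewrite big1 // => K _; rewrite mulr0.
rewrite -sumrB big_seq [RHS]big_seq; apply: eq_bigr => K KF.
by rewrite norm ?flag_upset // (cutsE _ (flag_upset rs' KF) e) mulrBr.
Qed.

(** The empty filter does not contribute here, so [pot c] has the same gradient as the indicator of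
    K; both are 0 at the bottom, hence equal. *)
Lemma pot_up c K : upset Y' K -> spans c (m |: K) ->
  (forall z, z \in s -> pot c z = (z \in K)%:R) /\ tot c = 1.
Proof.
move=> uK H; have uJ := upset_cons rs uK.
have c0 : c set0 = 0 by apply: span_top uJ _ H; rewrite // !inE eqxx.
have E a b : edge Y' a b ->
    hi (tot c) (pot c) b - lo (pot c) a = (oin K b)%:R - (inlo K a)%:R.
  by move=> e; rewrite -(cutsE _ uK e) -norm // (col_eq H e) c0 mul0r add0r.
have P z : z \in s -> pot c z = (z \in K)%:R.
  move=> zs; apply/eqP; rewrite -subr_eq0; apply/eqP.
  apply: (potential_bot (Y := Y') (J := set0) (u := fun z => pot c z - (z \in K)%:R)); rewrite ?inE //.
  move=> a y /E /= e _; rewrite (_ : lo _ a = lo (pot c) a - (inlo K a)%:R); last first.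
    by case: (a); rewrite //= subr0.
  by move/eqP: e; rewrite subr_eq => /eqP ->; ring.
split=> //; have [a e] := edge_top Y'; have := E _ _ e => /=.
suff -> : lo (pot c) a = (inlo K a)%:R by move/addIr.
by case/edgeP: e; case: (a) => //= x; rewrite inE => /P.
Qed.

(** The row is interpolated on the flag by [flag_affine]; by [pot_up] the expansion of any filter
    containing m reproduces its membership values, so the formula holds for it too. The clause for
    arbitrary c serves the columns of filters avoiding m. *)
Lemma facet_m_affine a : edge Y a (Some m) -> exists f0 (fz : X -> A),
  (forall c, \sum_(K <- flag s) c (m |: K) * M a (Some m) (m |: K) =
     f0 * tot c + \sum_(z <- s) fz z * pot c z)
  /\ forall K, upset Y' K ->
     M a (Some m) (m |: K) = f0 + \sum_(z <- s) fz z * (z \in K)%:R.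
Proof.
move=> e; have us : uniq s by case/andP: rs'.
have [f0 [fz H]] := flag_affine (fun K => M a (Some m) (m |: K)) us.
have E c : \sum_(K <- flag s) c (m |: K) * M a (Some m) (m |: K) =
     f0 * tot c + \sum_(z <- s) fz z * pot c z.
  under [X in _ + X]eq_bigr => z _ do rewrite mulr_sumr.
  rewrite exchange_big mulr_sumr -big_split; apply: eq_big_seq => K KF /=.
  rewrite H // mulrDr mulrC; congr (_ + _); rewrite mulr_sumr.
  by apply: eq_bigr => z _; rewrite mulrCA.
exists f0, fz; split=> // K uK; have uJ := upset_cons rs uK.
have [c Hc] := spanM uJ; have [P1 P2] := pot_up uK Hc.
rewrite (Hc _ _ e) span_big // (span_top uJ _ Hc) ?mul0r ?add0r ?E ?P2 ?mulr1; last first.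
  by rewrite !inE eqxx.
by congr (_ + _); apply: eq_big_seq => z /P1 ->.
Qed.

Let over a := [set z in s | olt a (Some z)].

(* An affine function of the filter satisfies f(K) + f(L) = f(K u L) + f(K n L);
   for L the elements above or equal to a, the values at L and K u L vanish. *)
Lemma facet_m_restrict a K : edge Y a (Some m) -> upset Y' K -> ~~ inlo K a ->
  M a (Some m) (m |: K) = M a (Some m) (m |: (K :&: over a)).
Proof.
move=> e uK aK; case: a e aK => [x|] e aK; last first.
  congr (M _ _ (_ |: _)); apply/setP=> z; rewrite !inE andbT.
  by case zK: (z \in K) => //; case/upsetP: uK => /subsetP/(_ z zK); rewrite inE => ->.
have [f0 [fz [_ H]]] := facet_m_affine e.
case/edgeP: (e) => /= xY _ xm Hx.
have {xY} xs : x \in s.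
  by move: xY; rewrite !inE => /orP[/eqP xm'|//]; rewrite xm' ltxx in xm.
case/upsetP: uK (uK) => /subsetP sK hK uK.
set W := over _; pose L := x |: W.
have xW : x \notin W by rewrite !inE /= ltxx andbF.
have up z y : z \in W -> y \in s -> (z <= y)%O -> y \in W.
  by rewrite !inE /= => /andP[_ xz] -> /(lt_le_trans xz).
have uKW : upset Y' (K :&: W).
  apply/upsetP; split=> [|z y].
    by apply/subsetP=> z /setIP[/sK].
  case/setIP=> zK zW yY zy; rewrite inE (hK _ _ zK yY zy) /=.
  by apply: up zW _ zy; rewrite inE in yY.
have uL : upset Y' L.
  apply/upsetP; split=> [|z y].
    by apply/subsetP=> z; rewrite !inE => /orP[/eqP->|/andP[]].
  rewrite in_setU1 => /orP[/eqP->|zW] yY zy; last first.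
    by rewrite in_setU1 (up z) ?orbT //; rewrite inE in yY.
  move: yY; rewrite !inE eq_sym /= => ys; rewrite ys /=; rewrite lt_neqAle zy andbT.
  by case: eqP.
have uKL : upset Y' (K :|: L).
  case/upsetP: uL => /subsetP sL hL; apply/upsetP; split=> [|z y].
    by apply/subsetP=> z /setUP[/sK|/sL].
  by case/setUP=> [zK|zL] yY zy; rewrite inE ?(hK _ _ zK yY zy) ?(hL _ _ zL yY zy) ?orbT.
have Z B : upset Y' B -> x \in B -> M (Some x) (Some m) (m |: B) = 0.
  by move=> uB xB; apply: M_zero e (upset_cons rs uB) _; rewrite /cuts /= !inE xB orbT.
have := Z _ uL (setU11 _ _); have := Z _ uKL; rewrite inE setU11 orbT => /(_ isT).
rewrite !H // => E0 E2; have {E0 E2}/addrI E1 := etrans E0 (esym E2).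
congr (_ + _); apply/eqP; rewrite -subr_eq0. rewrite -sumrB.
move/eqP: E1; rewrite -subr_eq0 -sumrB => /eqP E1.
rewrite -[X in _ == X]E1; apply/eqP; apply: eq_bigr => z _.
rewrite -!mulrBr; congr (_ * _); rewrite /L !in_setU in_setI in_set1.
case: (eqVneq z x) => [->|_] /=; last by case: (z \in K) (z \in W) => [] [] /=; rewrite ?subrr ?subr0.
by rewrite /= in aK; rewrite (negPf aK) (negPf xW) /= !subrr.
Qed.

(** The entry at the empty filter of the facet t_x = 1 with x other than m. Maximal elements other
    than m are incomparable to m, so by width two there is at most one; the value is 1 if there is
    none. *)
Let kap :=
  if [pick x | edge Y (Some x) None && (x != m)] is Some x
  then M (Some x) None set0 else 1.

Lemma kapE x : edge Y (Some x) None -> x != m -> M (Some x) None set0 = kap.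
Proof.
have F y : edge Y (Some y) None -> y != m -> y \in s /\ ~~ (y < m)%O.
  case/edgeP=> /=; rewrite !inE => /orP[->//|ys] _ _ H ym; split=> //.
  by apply/negP => /H; apply; rewrite ?inE ?eqxx.
move=> e xm; rewrite /kap; case: pickP => [y /andP[ey ym]|/(_ x)]; last by rewrite e xm.
have [[xs nx] [ys ny]] := (F _ e xm, F _ ey ym).
suff -> : x = y by [].
have G v z : edge Y (Some v) None -> z \in s -> (v <= z)%O -> v = z.
  case/edgeP=> _ _ _ H zs vz; apply/eqP/negPn/negP => nvz.
  by apply: (H z); rewrite ?inE ?zs ?orbT //= lt_neqAle nvz.
by case/orP: (chain xs ys nx ny) => [/G|/G/esym]; apply.
Qed.

Lemma kap_unit : kap \is a GRing.unit.
Proof.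
rewrite /kap; case: pickP => [y /andP[ey ym]|]; last by rewrite unitr1.
by apply: M_unit; rewrite // /cuts /= inE.
Qed.

(* A filter J avoiding m consists of elements incomparable to m, a chain. By
   col_eq its column is the gradient of a potential, which vanishes off J and
   is constant on J. *)
Lemma low_column J : upset Y J -> m \notin J -> exists t g, [/\ t \is a GRing.unit,
  forall a b, edge Y a b -> b <> Some m -> a <> Some m -> M a b J = t * (cuts J a b)%:R,
  M (Some m) None J = M (Some m) None set0 / kap * (t * g)
  & forall a, edge Y a (Some m) -> M a (Some m) (m |: J) = M a (Some m) (m |: set0) * g].
Proof.
move=> uJ mJ; case: (set_0Vmem J) => [->|[j jJ]].
  exists kap, 1; split; first exact: kap_unit.
  - move=> a b e bm am; case cu: (cuts set0 a b); last first.
      by rewrite mulr0 M_zero // ?cu.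
    rewrite mulr1; move: cu; rewrite /cuts; case: b e bm => [y|] /= e bm; rewrite ?inE ?andbF //.
    case: a e am => [x|] e am _; first by apply: kapE => //; apply/eqP => xm; rewrite xm in am.
    by case/edgeP: e => _ _ _ /(_ m); rewrite !inE eqxx => /(_ isT isT isT).
  - by rewrite mulr1 divrK ?kap_unit.
  - by move=> a _; rewrite mulr1.
have uJ' := upset_m uJ mJ.
(* The value of the potential on J: the row of an edge (x, top) with x in J vanishes at J and reads
   0 = c set0 * kap + tot c - pot c x. *)
have [c H] := spanM uJ; set t := tot c + c set0 * kap.
have bot z : z \in s -> z \notin J -> pot c z = 0.
  move=> zs zJ; apply: potential_bot uJ' _ _ _ zJ; last by rewrite inE.
  move=> a y e yJ; have := col_eq H e => /=; rewrite !M_zero //.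
  - by rewrite mulr0 add0r => /esym/eqP; rewrite subr_eq0 => /eqP.
  - exact: (edge_bs e).
  - by rewrite /cuts /= inE andbF.
  - exact: (edge_bs e).
  - by rewrite /cuts /= (negPf yJ) andbF.
have top z : z \in J -> pot c z = t.
  apply: potential_top uJ' _ _ => x b e xJ.
  have := col_eq H e; rewrite M_zero; [|exact: (edge_bs e)|by []|by rewrite /cuts /= xJ].
  have ebs := edge_bs e.
  case: b e ebs => [y|] /= e ebs.
    rewrite (M_zero ebs (upset0 _)) ?mulr0 ?add0r; last by rewrite /cuts /= !inE.
    by move/esym/eqP; rewrite subr_eq0 => /eqP.
  case: ifP ebs => [en _|en exm].
    rewrite kapE //; first by move/esym/eqP; rewrite subr_eq0 addrC => /eqP.
    by apply: contraNneq mJ => <-.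
  case/edgeP: exm => _ _ xm _; have := upset_below uJ mJ xJ; by rewrite /= in xm; rewrite xm.
have potE z : z \in s -> pot c z = t * (z \in J)%:R.
  by move=> zs; case zJ: (z \in J); [rewrite mulr1 top|rewrite mulr0 bot // zJ].
have E a b : edge Y a b -> b <> Some m -> a <> Some m -> M a b J = t * (cuts J a b)%:R.
  move=> e bm am; have [e' bsb] := edge_bs_inv e bm am.
  have := col_eq H e'; rewrite bsb => ->.
  have loE : lo (pot c) a = t * (inlo J a)%:R.
    by case/edgeP: e'; case: (a) => [x|] /=; rewrite ?mulr0 // inE => /potE.
  rewrite (cutsE _ uJ e) mulrBr loE; congr (_ - _).
  case: b e bm bsb e' => [y|] /= e bm bsb e'.
    case/edgeP: e' => _; rewrite /= inE => ys _ _.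
    by rewrite M_zero ?mulr0 ?add0r ?potE // /cuts /= inE andbF.
  case: a e am {loE e' bsb} => [x|] e am; last first.
    by case/edgeP: e => _ _ _ /(_ m); rewrite !inE eqxx => /(_ isT isT isT).
  by rewrite kapE 1?addrC ?mulr1 //; apply/eqP => xm; rewrite xm in am.
(* An edge entering a minimal element of J is cut by J, and its entry, a unit, equals t. *)
have tu : t \is a GRing.unit.
  have jY : j \in Y by case/upsetP: uJ => /subsetP/(_ _ jJ).
  case: (@arg_minnP _ j (fun z => z \in J) (fun c => #|[set w : X | (w < c)%O]|) jJ) => y yJ ymin.
  have yY : y \in Y by case/upsetP: uJ => /subsetP/(_ _ yJ).
  have [a e] := edge_into yY.
  have cu : cuts J a (Some y).
    rewrite /cuts /= yJ andbT; case/edgeP: e; case: (a) => //= x _ _ xy _.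
    by apply/negP => /ymin; rewrite /= leqNgt card_below.
  have := M_unit e uJ cu; rewrite E ?cu ?mulr1 //.
    by move=> [ym]; rewrite -ym yJ in mJ.
  by move=> am; rewrite am in e; have := edge_m e.
(* On the facet (m, top) only the column of the empty filter survives, with coefficient c set0;
   writing c set0 * kap = t * g gives g. *)
exists t, (c set0 * kap / t); split=> //.
  have -> : M (Some m) None J = c set0 * M (Some m) None set0.
    rewrite (H _ _ edge_mN) span_big // big_seq big1 ?addr0 // => K KF.
    by rewrite M_zero ?mulr0 //; [apply: upset_cons => //; apply: flag_upset|rewrite /cuts /= !inE eqxx].
  by rewrite [t * _]mulrC divrK // mulrACA mulVr ?kap_unit // mulr1 mulrC.
(* The facet (a, m) vanishes on J and on the empty filter, so f0 * tot c + t * S = 0 with S the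
   linear part at J; hence t * (f0 + S) = f0 * (c set0 * kap). *)
move=> a e; have [f0 [fz [F1 F2]]] := facet_m_affine e.
apply: (mulIr tu); rewrite -!mulrA mulVr // mulr1.
have up0 : upset Y' set0 by [].
have := H _ _ e; rewrite span_big // F1 M_zero ?mulr0 //; last by rewrite /cuts /= (negPf mJ) andbF.
rewrite M_zero // ?mulr0 ?add0r; last by rewrite /cuts /= inE andbF.
rewrite !F2 // [\sum_(z <- s) _ * (z \in set0)%:R]big1 ?addr0; last by move=> z _; rewrite inE mulr0.
rewrite (_ : \sum_(z <- s) fz z * pot c z = t * \sum_(z <- s) fz z * (z \in J)%:R); last first.
  by rewrite mulr_sumr; apply: eq_big_seq => z /potE ->; rewrite mulrCA.
set S := \sum_(z <- s) _ => /esym E0.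
transitivity (f0 * (c set0 * kap) + (f0 * tot c + t * S)); first by rewrite /t; ring.
by rewrite E0 addr0.
Qed.

Hypothesis down : forall y z, z \in m :: s -> (y <= z)%O -> y \in m :: s.
Variable rho : X -> nat.
Hypothesis rhoP : forall x y, covered_by x y -> rho y = (rho x).+1.
Hypothesis rho_lt : forall x y, (x < y)%O -> (rho x < rho y)%N.

(** As m :: s is a down-set, an edge between two of its elements is a cover in X. *)
Let down_edge x y : edge Y (Some x) (Some y) -> rho y = (rho x).+1.
Proof.
case/edgeP=> /= xY yY xy H; apply: rhoP; split=> // -[z [xz zy]].
by apply: (H z) => //; rewrite inE; apply: down (ltW zy); rewrite inE in yY.
Qed.

Let edge_some x y : edge Y' (Some x) (Some y) -> edge Y (Some x) (Some y).
Proof. exact: edge_bs. Qed.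

Lemma upset_over a K : edge Y a (Some m) -> upset Y' K -> upset Y (K :&: over a).
Proof.
case/edgeP=> aY _ am H /upsetP[/subsetP sK uK]; apply/upsetP; split=> [|x y].
  by apply/subsetP=> x /setIP[/sK]; rewrite !inE => ->; rewrite orbT.
case/setIP=> xK; rewrite inE => /andP[xs ax]; rewrite in_set in_cons.
case/orP=> [/eqP-> xm|ys xy].
  case: (eqVneq x m) xs => [->|nxm xs]; first by rewrite (negPf ms).
  by case: (H x); rewrite ?inE ?xs ?orbT //= lt_neqAle nxm.
rewrite inE (uK x y) ?inE //= ys /=.
by case: (a) ax => //= w; move/lt_le_trans; apply.
Qed.

Let over_notin a : ~~ inlo (over a) a.
Proof. by case: a => //= x; rewrite inE /= ltxx andbF. Qed.

(* This is where rankedness is needed. *)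
Lemma over_eq a a' :
  (forall c, edge Y c (Some m) -> ~~ edge Y' c None) ->
  edge Y a (Some m) -> edge Y a' (Some m) -> over a = over a'.
Proof.
move=> nm; wlog suff sub : a a' / edge Y a (Some m) -> edge Y a' (Some m) -> over a \subset over a'.
  by move=> e e'; apply/eqP; rewrite eqEsubset !sub.
have no v : edge Y (Some v) (Some m) -> ~~ edge Y None (Some m).
  by case/edgeP=> vY _ vm _; apply/negP => /edgeP[_ _ _ /(_ v vY isT)]; apply.
move=> e e'; case: a a' e e' => [x|] [x'|] e e'.
- have E v : edge Y (Some v) (Some m) -> v \in s.
  by case/edgeP=> /=; rewrite !inE => /orP[/eqP->|//]; rewrite ltxx.
  have nl v c : edge Y (Some v) (Some m) -> edge Y' (Some v) (Some c) -> ~~ (c < m)%O.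
  case/edgeP=> _ _ _ H /edgeP[_]; rewrite /= inE => cs vc _; apply/negP.
  by apply: H; rewrite // !inE cs orbT.
  apply/subsetP=> z; rewrite !inE /= => /andP[zs xz]; rewrite zs /=.
  have [c ec cz] : exists2 c, edge Y' (Some x) (Some c) & (c <= z)%O.
    by apply: edge_up; rewrite //= ?inE ?(E _ e).
  have [b eb] : exists b, edge Y' (Some x') b by apply: edge_from; rewrite inE (E _ e').
  case: b eb => [c' ec'|eb]; last by have := nm _ e'; rewrite eb.
  have cs : c \in s by case/edgeP: ec => _; rewrite /= inE.
  have cs' : c' \in s by case/edgeP: ec' => _; rewrite /= inE.
  (* Since m covers both x and x', their covers c and c' have equal rank. Neither is below m, so
     they are comparable, and comparable elements of equal rank coincide. *)
  have rc : rho c = rho c'.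
    by rewrite (down_edge (edge_some ec)) (down_edge (edge_some ec')) -(down_edge e) -(down_edge e').
  suff cc : c' = c by apply: lt_le_trans cz; case/edgeP: ec' => _ _; rewrite cc.
  have := chain cs cs' (nl _ _ e ec) (nl _ _ e' ec').
  by rewrite !le_eqVlt => /orP[/orP[/eqP//|/rho_lt]|/orP[/eqP//|/rho_lt]]; rewrite rc ltnn.
- by have := no _ e; rewrite e'.
- by have := no _ e'; rewrite e.
- exact: subxx.
Qed.

(* The normalization of the columns containing m is unique only up to a factor
   G depending on the part of the filter over the lower covers of m; G is chosen
   so that the facets (a, m) become constant. *)
Lemma step_factor : exists r t, forall a b J, edge Y a b -> upset Y J ->
  cuts J a b -> M a b J = r a b * t J.
Proof.
pose P J (tg : A * A) := upset Y J -> m \notin J -> [/\ tg.1 \is a GRing.unit,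
  forall a b, edge Y a b -> b <> Some m -> a <> Some m -> M a b J = tg.1 * (cuts J a b)%:R,
  M (Some m) None J = M (Some m) None set0 / kap * (tg.1 * tg.2)
  & forall a, edge Y a (Some m) -> M a (Some m) (m |: J) = M a (Some m) (m |: set0) * tg.2].
have /fin_all_exists[tg low] J : exists u, P J u.
  case: (boolP (upset Y J && (m \notin J))) => [/andP[u n]|H].
    by have [t [g ?]] := low_column u n; exists (t, g) => _ _.
  by exists (1, 1) => u n; rewrite u n in H.
pose g J := (tg J).2.
(* G rescales the columns of the filters containing m, and [Gam b], its constant value on the
   support of a row (a, b), is divided out of that row. Agreement with g on low filters makes the
   row (m, top) factor. *)
suff [G [Gam [G1 G2 G3 G4]]] : exists G Gam, [/\
    forall K, upset Y' K -> G K \is a GRing.unit,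
    forall J, upset Y J -> m \notin J -> G J = g J,
    forall a K, edge Y a (Some m) -> upset Y' K -> ~~ inlo K a ->
      M a (Some m) (m |: K) = M a (Some m) (m |: set0) * G K
    & forall a b K, edge Y' a b -> upset Y' K -> cuts K a b -> G K = Gam b :> A].
  exists (fun a b => if a == Some m then M (Some m) None set0 / kap
                     else if b == Some m then M a (Some m) (m |: set0)
                     else (Gam b)^-1),
    (fun J => if m \in J then G (J :\ m) else (tg J).1 * G J) => a b J e uJ cu.
  have [am|/eqP am] := eqVneq a (Some m).
    move: e cu; rewrite am => e; rewrite (edge_m e) /cuts /= andbT => mJ.
    by rewrite (negPf mJ) G2 //; case: (low J uJ mJ).
  have [bm|/eqP bm] := eqVneq b (Some m).
    move: e cu; rewrite bm /cuts /= => e /andP[aJ mJ]; rewrite mJ -G3 ?setD1K //.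
      exact: upset_mD.
    by case: (a) aJ => //= x; rewrite inE negb_and => ->; rewrite orbT.
  have [e' bsb] := edge_bs_inv e bm am.
  case: ifP => mJ.
    have uK := upset_mD uJ; have := norm e' uK; rewrite bsb setD1K // => ->.
    have cu' : cuts (J :\ m) a b by rewrite -(cuts_bs _ e') bsb setD1K.
    by rewrite -(G4 _ _ _ e' uK cu') cu' mulVr // G1.
  have uK := upset_m uJ (negbT mJ); case: (low J uJ (negbT mJ)) => _ /(_ _ _ e bm am) -> _ _.
  by rewrite -(G4 _ _ _ e' uK cu) cu mulr1 mulrCA mulVr ?mulr1 // G1.
have uo a K : edge Y a (Some m) -> upset Y' K ->
    upset Y (K :&: over a) /\ m \notin K :&: over a.
  by move=> e u; split; [exact: upset_over|rewrite !inE (negPf ms) andbF].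
have restr a K : edge Y a (Some m) -> upset Y' K -> ~~ inlo K a ->
    M a (Some m) (m |: K) = M a (Some m) (m |: set0) * g (K :&: over a).
  move=> e u na; rewrite facet_m_restrict //; have [u' n] := uo _ _ e u.
  by case: (low _ u' n) => _ _ _; apply.
(* If a lower cover a of m is maximal in the rest, its facet (a, m) is among the normalized ones,
   which forces every g to be 1. *)
case: (boolP [exists a, edge Y a (Some m) && edge Y' a None]) => [/existsP[a /andP[e e']]|].
  have bsa : bs a None = Some m.
    rewrite /bs; case: ifP => // /edgeP[_ _ _ /(_ m)]; rewrite !inE eqxx.
    by case/edgeP: e => _ _ -> _ /(_ isT isT isT).
  have g1 J : upset Y J -> m \notin J -> g J = 1.
    move=> uJ mJ; case: (low J uJ mJ) => _ _ _ /(_ _ e).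
    have := norm e' (upset_m uJ mJ); have := norm e' (upset0 _); rewrite bsa => -> ->.
    have -> : cuts set0 a None by rewrite /cuts; case: (a) => //= x; rewrite inE.
    have -> : cuts J a None.
      rewrite /cuts andbT; case/edgeP: e => _ _; case: (a) => //= x xm _.
      by apply/negP => xJ; case/negP: (upset_below uJ mJ xJ).
    by rewrite mul1r.
  exists (fun=> 1), (fun=> 1); split=> //; first by move=> *; exact: unitr1.
    by move=> J uJ mJ; rewrite g1.
  by move=> c K ec uK na; rewrite restr // g1 //; case: (uo _ _ ec uK).
move=> /existsPn nm'.
have nm c : edge Y c (Some m) -> ~~ edge Y' c None.
  by move=> ec; have := nm' c; rewrite ec.
have [a0 e0] : exists a, edge Y a (Some m) by apply: edge_into; rewrite !inE eqxx.
(* By [over_eq] W is the same for every lower cover, so one G serves all facets (a, m). *)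
pose W := over a0; pose G K := g (K :&: W).
pose upc b := if b is Some y then [set z in s | (y <= z)%O] else set0.
have a0m : a0 <> Some m.
  by move=> a0m; move: e0; rewrite a0m => /edgeP[_ _ /=]; rewrite ltxx.
have ninlo K : ~~ inlo (m |: (K :&: W)) a0.
  have := over_notin a0; rewrite /W; case: (a0) a0m => //= x xm nx.
  by rewrite in_setU1 in_setI negb_or negb_and nx orbT andbT; apply/eqP => h; rewrite h in xm.
exists G, (fun b => G (upc b)); split.
- move=> K uK; have [u n] := uo _ _ e0 uK.
  case: (low _ u n) => _ _ _ /(_ _ e0) E.
  have : M a0 (Some m) (m |: (K :&: W)) \is a GRing.unit.
    apply: M_unit => //; first exact/upset_cons/upset_m.
    by rewrite /cuts ninlo /= !inE eqxx.
  by rewrite E unitrM => /andP[].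
- move=> J uJ mJ; case: (low J uJ mJ) => _ _ _ /(_ _ e0).
  have nJ : ~~ inlo J a0.
    case/edgeP: e0 => _ _; case: (a0) => //= x xm _.
    by apply/negP => xJ; case/negP: (upset_below uJ mJ xJ).
  rewrite (restr _ _ e0 (upset_m uJ mJ) nJ); apply/mulrI; apply: M_unit => //.
    exact: upset_cons (upset0 _).
  rewrite /cuts /= !inE eqxx andbT; case: (a0) a0m => //= x xm.
  by rewrite !inE orbF; apply/eqP => h; rewrite h in xm.
- by move=> a K e uK na; rewrite restr // /G /W (over_eq nm e e0).
(* An element of W in K that is not above or equal to b would lie strictly between a and b; so K
   meets W exactly in the elements above or equal to b. *)
move=> a b K e uK /andP[aK bK]; rewrite /G; congr g; apply/setP=> z.
rewrite !in_setI; case zW: (z \in W); rewrite ?andbF // !andbT.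
case/upsetP: uK => /subsetP sK hK.
apply/idP/idP => [zK|]; last first.
  case: b e bK => [y|] /= e yK; rewrite inE // => /andP[zs yz].
  by apply: hK yK _ yz; rewrite inE.
have zs : z \in s by move: (sK _ zK); rewrite inE.
(* W lies above every lower cover of m, by [over_eq], hence above every element below m. *)
have below y : (y < m)%O -> y \in s -> (y < z)%O.
  move=> ym ys; have [c ec yc] : exists2 c, edge Y (Some c) (Some m) & (y <= c)%O.
    by apply: edge_down; rewrite //= !inE ?eqxx ?ys ?orbT.
  apply: le_lt_trans yc _; move: zW; rewrite /W -(over_eq nm ec e0).
  by rewrite inE => /andP[].
have zm : ~~ (z < m)%O.
  move: zW; rewrite inE => /andP[_ az]; apply/negP => zm.
  by case/edgeP: e0 => _ _ _ /(_ z); apply; rewrite // !inE zs orbT.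
case/edgeP: e => aY bY ab H; apply/negPn/negP => zb.
apply: (H z); first by rewrite inE.
- case: a aY aK {ab H} => //= y; rewrite inE => ys yK.
  case: (boolP (y < m)%O) => [ym|ym]; first exact: below.
  case/orP: (chain ys zs ym zm) => h.
    by rewrite lt_neqAle h andbT; apply: contraNneq yK => ->.
  by rewrite (hK z y) ?inE in yK.
- case: b bY bK zb {ab H} => //= y; rewrite !inE => ys yK; rewrite zs /= => nyz.
  case: (boolP (y < m)%O) => [ym|ym]; first by rewrite (ltW (below _ ym ys)) in nyz.
  have := chain ys zs ym zm; rewrite (negPf nyz) /= lt_neqAle => ->; rewrite andbT.
  by apply: contraNneq nyz => ->.
Qed.

End Step.

(** * Induction along a linear extension *)

Section Factorization.
Context {disp : Order.disp_t} {X : finPOrderType disp} {A : comUnitRingType}.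
Hypothesis width2 : forall x y z : X, (x >< y)%O -> (y >< z)%O -> (x >< z)%O -> False.
Variable rho : X -> nat.
Hypothesis rhoP : forall x y, covered_by x y -> rho y = (rho x).+1.

Lemma rank_lt (x y : X) : (x < y)%O -> (rho x < rho y)%N.
Proof.
have [n] := ubnP (#|X| - #|[set w : X | (w < x)%O]|); elim: n x => // n IH x.
rewrite ltnS => le_n xy.
have [c e cy] : exists2 c, edge [set: X] (Some x) (Some c) & (c <= y)%O.
  exact: (@edge_up _ _ [set: X] (Some x) y (in_setT x) (in_setT y) xy).
have xc : (x < c)%O by case/edgeP: e.
have lt_c : (rho x < rho c)%N.
  rewrite (rhoP (x := x) (y := c)) //; split=> // -[z [xz zc]].
  by case/edgeP: e => _ _ _ /(_ z); rewrite inE; apply.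
move: cy; rewrite le_eqVlt => /orP[/eqP <- //|cy].
apply: ltn_trans lt_c _; apply: IH cy; apply: leq_trans le_n.
apply: ltn_sub2l (card_below xc); exact: leq_trans (card_below xc) (max_card _).
Qed.

(** The factors given by the induction are known to be units only where they occur in a unit entry;
    replacing the others by 1 allows division everywhere. *)
Let uinv (x : A) := if x \is a GRing.unit then x^-1 else 1.
Let uinv_unit x : uinv x \is a GRing.unit.
Proof. by rewrite /uinv; case: ifP => h; rewrite ?unitrV ?unitr1. Qed.

Theorem slack_factorization (s : seq X) (M : option X -> option X -> {set X} -> A) :
  revext s -> (forall y z, z \in s -> (y <= z)%O -> y \in s) ->
  supported [set x in s] M -> flag_spanned s M ->
  exists r t, forall a b J, edge [set x in s] a b -> upset [set x in s] J ->
    cuts J a b -> M a b J = r a b * t J.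
Proof.
elim: s M => [|m s IH] M rs down supp span.
  exists (fun a b => M a b set0), (fun=> 1) => a b J _ /upsetP[/subsetP sJ _] _.
  rewrite mulr1; congr M; apply/setP=> z; rewrite inE.
  by apply/negP => /sJ; rewrite inE.
have [ms mmax rs'] := revext_cons rs.
have down' y z : z \in s -> (y <= z)%O -> y \in s.
  move=> zs yz; have := down y z; rewrite !inE zs orbT => /(_ isT yz) /orP[/eqP ym|//].
  have := mmax _ zs; rewrite lt_neqAle -ym yz andbT negbK => /eqP yz'.
  by rewrite yz' zs.
have [r [t H]] := IH _ rs' down' (supported_tail rs supp) (flag_spanned_tail rs supp span).
(* A facet (a, m) inherited from the rest is the image under [bs] of (a, top) and takes its row
   factor. *)
pose rh a b := uinv (r a (if b == Some m then None else b)).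
pose th (J : {set X}) := if m \in J then uinv (t (J :\ m)) else 1.
have rhu a b : rh a b \is a GRing.unit by exact: uinv_unit.
have thu J : th J \is a GRing.unit by rewrite /th; case: ifP; rewrite ?unitr1.
pose M1 a b J := M a b J * (rh a b * th J).
have supp1 : supported [set x in m :: s] M1.
  move=> a b J e u; have := supp a b J e u; case: ifP => _; first by rewrite !unitrM rhu thu andbT => ->.
  by move/eqP=> E; rewrite /M1 E mul0r.
have span1 : flag_spanned (m :: s) M1.
  move=> J u; have [c Hc] := span J u; exists (fun K => c K * (th J / th K)) => a b e.
  rewrite /M1 (Hc _ _ e) mulr_suml; apply: eq_bigr => K _.
  transitivity (c K * M a b K * (rh a b * th J * (th K / th K))); last by ring.
  by rewrite mulrV // mulr1.
have norm a b K : edge [set x in s] a b -> upset [set x in s] K ->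
    M1 a (bs m s a b) (m |: K) = (cuts K a b)%:R.
  move=> e u; have := supported_tail rs supp e u; case: ifP => cu /=; last first.
    by move=> /eqP E; rewrite /M1 E mul0r.
  have mK := notin_m rs u.
  rewrite /M1 (H _ _ _ e u cu) unitrM => /andP[ru tu].
  have -> : rh a (bs m s a b) = (r a b)^-1.
    rewrite /rh (_ : (if _ then _ else _) = b) /uinv ?ru //.
    case: b e {cu ru} => [y|] e /=; last by case: (edge _ _ _) => //=; rewrite eqxx.
    case: eqP => // -[ym]; case/edgeP: e => _ /=; by rewrite inE ym (negPf ms).
  have -> : th (m |: K) = (t K)^-1 by rewrite /th setU11 setU1K // /uinv tu.
  by rewrite mulrACA !mulrV // mulr1.
have chain y z : y \in s -> z \in s -> ~~ (y < m)%O -> ~~ (z < m)%O -> (y <= z)%O || (z <= y)%O.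
  have inc w : w \in s -> ~~ (w < m)%O -> (m >< w)%O.
    move=> ws wm; have := mmax _ ws; move: wm; rewrite !lt_neqAle comparable_sym /Order.comparable.
    have -> : w != m by apply: contraNneq ms => <-.
    have -> : m != w by apply: contraNneq ms => ->.
    by rewrite negb_or => -> ->.
  move=> ys zs ym zm; apply/negPn/negP => yz.
  apply: (width2 (inc _ ys ym) _ (inc _ zs zm)); exact: yz.
have [r1 [t1 H1]] := step_factor rs supp1 span1 norm chain down rhoP rank_lt.
exists (fun a b => r1 a b / rh a b), (fun J => t1 J / th J) => a b J e u cu.
apply: (mulIr (rhu a b)); apply: (mulIr (thu J)); rewrite -mulrA -/(M1 a b J) H1 //.
transitivity (r1 a b * t1 J * (rh a b / rh a b) * (th J / th J)); last by ring.
by rewrite !mulrV // !mulr1.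
Qed.

End Factorization.
(** * Vanishing minors *)

Section Minors.

Lemma increasing_perm k m (f : 'I_k -> 'I_m) : injective f ->
  exists s : 'S_k, {homo (fun a => f (s a)) : a b / (a < b)%N}.
Proof.
move=> fi; pose B a := [set b | (f b < f a)%N].
have Bk a : (#|B a| < k)%N.
  rewrite -[X in (_ < X)%N](card_ord k) -cardsT; apply: proper_card.
  by apply/properP; split; [exact: subsetT|exists a; rewrite !inE ?ltnn].
have Blt a b : (f a < f b)%N -> (#|B a| < #|B b|)%N.
  move=> ab; apply: proper_card; apply/properP; split.
    by apply/subsetP=> c; rewrite !inE => /ltn_trans; apply.
  by exists a; rewrite !inE ?ltnn.
pose h a := Ordinal (Bk a).
have hi : injective h.
  move=> a b /(congr1 val)/= E; apply: fi; apply: val_inj => /=.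
  by case: (ltngtP (f a) (f b)) => // /Blt; rewrite E ltnn.
exists (perm hi)^-1%g => a b ab.
have hK c : #|B ((perm hi)^-1%g c)| = c.
  by rewrite -[RHS](congr1 val (permKV (perm hi) c)) permE.
rewrite ltnNge; apply: contraTN ab; rewrite leq_eqVlt -leqNgt => /orP[/eqP E|].
  by rewrite (perm_inj (fi _ _ (val_inj E))).
by move/Blt; rewrite !hK; apply: ltnW.
Qed.

(** A repeated index gives 0, and sorting the indices changes only the sign. *)
Lemma minors_any (A : comNzRingType) m n k (M : 'M[A]_(m, n)) :
  (forall p, is_minor k M p -> p = 0) ->
  forall f g, \det (mxsub f g M : 'M_k) = 0.
Proof.
move=> H f g.
case: (boolP (injectiveb f)) => [/injectiveP fi|]; last first.
  move/injectivePn=> [a [b ab fab]]; apply: (determinant_alternate ab) => j.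
  by rewrite !mxE fab.
case: (boolP (injectiveb g)) => [/injectiveP gi|]; last first.
  move/injectivePn=> [a [b ab gab]]; rewrite -det_tr; apply: (determinant_alternate ab) => j.
  by rewrite !mxE gab.
have [[s sf] [t tg]] := (increasing_perm fi, increasing_perm gi).
have E : mxsub (fun a => f (s a)) (fun a => g (t a)) M =
    row_perm s (col_perm t (mxsub f g M)) by apply/matrixP=> i j; rewrite !mxE.
have := H _ (ex_intro _ _ (ex_intro _ _ (And3 sf tg erefl))).
rewrite E row_permE col_permE !det_mulmx !det_perm odd_permV => D.
transitivity ((-1) ^+ s * ((-1) ^+ s * (\det (mxsub f g M) * (-1) ^+ t)) * (-1) ^+ t).
  by rewrite signrMK -mulrA -signr_addb addbb mulr1.
by rewrite D mulr0 mul0r.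
Qed.

(** In the minor bordered by row i and column j, the Schur complement of the unit minor vanishes;
    this expresses column j in the columns g with coefficients independent of i. *)
Lemma bordered_minors (A : comUnitRingType) m n k (N : 'M[A]_(m, n))
    (f : 'I_k -> 'I_m) (g : 'I_k -> 'I_n) :
  (forall f' g', \det (mxsub f' g' N : 'M_k.+1) = 0) ->
  \det (mxsub f g N) \is a GRing.unit ->
  forall j, exists c : 'I_k -> A, forall i, N i j = \sum_l c l * N i (g l).
Proof.
move=> H u j; pose M0 := mxsub f g N; pose w : 'cV_k := \col_a N (f a) j.
pose cv := invmx M0 *m w; exists (fun l => cv l 0) => i.
pose r : 'rV_k := \row_l N i (g l).
pose f' (a : 'I_(1 + k)) := match split a with inl _ => i | inr a => f a end.
pose g' (a : 'I_(1 + k)) := match split a with inl _ => j | inr a => g a end.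
have E : mxsub f' g' N = block_mx (N i j)%:M r w M0.
  apply/matrixP=> a b; rewrite !mxE /f' /g'.
  by case: (split a) => a'; rewrite !mxE; case: (split b) => b'; rewrite !mxE // !ord1.
have : \det (mxsub f' g' N *m block_mx 1%:M 0 (- cv) 1%:M) = 0.
  by rewrite det_mulmx H mul0r.
have M0cv : M0 *m cv = w by rewrite mulmxA mulmxV ?mul1mx // unitmxE.
rewrite E mulmx_block !mulmx1 !mulmx0 !mulmxN M0cv subrr !add0r.
rewrite det_ublock => /(congr1 (fun x => x / \det M0)).
rewrite mulrK // mul0r => /eqP.
rewrite det_mx11 !mxE eqxx mulr1n subr_eq0 => /eqP ->.
by apply: eq_bigr => l _; rewrite !mxE mulrC.
Qed.

End Minors.

(** * A unit minor on a maximal flag *)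

Section FlagMinor.
Context {disp : Order.disp_t} {X : finPOrderType disp}.
Implicit Types (s : seq X) (J K B : {set X}) (a b : option X) (x y z m : X).

Lemma revext_enum B : exists2 s, revext s & s =i B.
Proof.
have [n] := ubnP #|B|; elim: n B => // n IH B; rewrite ltnS => le_n.
case: (set_0Vmem B) => [->|[x xB]]; first by exists [::] => // x; rewrite !inE.
case: (@arg_maxnP _ x (fun z => z \in B) (fun c => #|[set w : X | (w < c)%O]|) xB) => m mB mmax.
have [|s /andP[us ps] sB] := IH (B :\ m).
  by apply: leq_trans le_n; rewrite [X in (_ < X)%N](cardsD1 m) mB.
exists (m :: s); last first.
  by move=> z; rewrite inE sB !inE; case: eqP => [->|].
rewrite /revext /= us ps sB !inE eqxx /= andbT; apply/allP=> z.
rewrite sB !inE => /andP[_ /mmax]; rewrite /= leqNgt; apply: contra => mz.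
exact: card_below.
Qed.

Lemma flagE s : flag s = [seq [set x in take l s] | l <- iota 0 (size s).+1].
Proof.
elim: s => [|m s IH]; first by congr [:: _]; apply/setP=> x; rewrite !inE.
change (set0 :: [seq m |: K | K <- flag s] = [set x in [::]] ::
  [seq [set x in take l (m :: s)] | l <- iota 1 (size s).+1]).
rewrite IH (iotaDl 1 0 (size s).+1 : iota 1 _ = _) -!map_comp; congr (_ :: _).
by apply: eq_map => l; apply/setP=> x; rewrite !inE.
Qed.

(* The facets e l make the square submatrix on the flag columns triangular. *)
Lemma flag_rows s : revext s -> (forall x, x \in s) ->
  exists e : 'I_(size s).+1 -> option X * option X,
    forall l, edge [set: X] (e l).1 (e l).2 /\
      forall l' : 'I_(size s).+1, (l <= l')%N ->
        cuts [set x in take l' s] (e l).1 (e l).2 = (l == l').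
Proof.
move=> /andP[us ps] sX.
suff H (l : 'I_(size s).+1) : exists e : option X * option X,
    edge [set: X] e.1 e.2 /\ forall l' : 'I_(size s).+1, (l <= l')%N ->
      cuts [set x in take l' s] e.1 e.2 = (l == l').
  by have [e] := fin_all_exists H; exists e.
(* The last flag member is the whole poset and takes an edge leaving the bottom. The l-th takes an
   edge (x, b) leaving the l-th element x: b is larger, so it comes before x in [s], while all later
   members contain x. *)
have [ld|ld] := ltnP l (size s); last first.
  have [b eb] : exists b, edge [set: X] None b.
    case: s us ps sX l ld => [|x0 s] us ps sX l ld.
      by exists None; apply/edgeP; split=> // z; have := sX z.
    have [c ec _] := @edge_up _ _ [set: X] None x0 isT (in_setT _) isT.
    by exists (Some c).
  exists (None, b); split=> // l' ll'.
  have -> : l' = l.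
    by apply: val_inj; apply/eqP; rewrite eqn_leq ll' (leq_trans _ ld) //= -ltnS.
  by rewrite eqxx take_oversize // /cuts /=; case: (b) => //= y; rewrite inE sX.
have [x0 _] : exists x0 : X, True by case: s {us ps sX} l ld => // x0; exists x0.
set x := nth x0 s l; have [b eb] := edge_from (in_setT x).
exists (Some x, b); split=> // l' ll'; rewrite /cuts /= inE.
have -> : (x \in take l' s) = (l < l')%N.
  by rewrite in_take ?sX // index_uniq.
rewrite -leqNgt -val_eqE eqn_leq ll' /=; case: leqP => //= l'l.
case: b eb => //= y /edgeP[_ _ /= xy _]; rewrite inE in_take ?sX //.
have yl : (index y s < size s)%N by rewrite index_mem.
rewrite ltnNge; apply/negP => l'y.
have /pairwiseP := ps; move/(_ x0 l (index y s)); rewrite !inE ld yl nth_index // -/x.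
rewrite xy /=; case: (ltngtP l (index y s)) => //= E; first by move/(_ isT isT isT).
  by have := leq_trans (leq_trans E ll') l'y; rewrite ltnn.
by move: xy; rewrite /x E nth_index // ltxx.
Qed.

Definition hasse := [set e : option X * option X | edge [set: X] e.1 e.2].
Definition filters := [set J : {set X} | upset [set: X] J].

Section Scaling.
Hypothesis width2 : forall x y z : X, (x >< y)%O -> (y >< z)%O -> (x >< z)%O -> False.
Hypothesis Xranked : ranked X.

(** The minor on [flag_rows] and the flag columns is a unit, so by [bordered_minors] the vanishing
    of the next larger minors makes the flag columns span, and [slack_factorization] applies. *)
Lemma slack_scaling (A : comUnitRingType) (N : 'M[A]_(#|hasse|, #|filters|)) :
  (forall i j, let e := enum_val i in
     if cuts (enum_val j) e.1 e.2 then N i j \is a GRing.unit else N i j == 0) ->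
  (forall p, is_minor #|X|.+2 N p -> p = 0) ->
  exists (r : 'I_#|hasse| -> A) (t : 'I_#|filters| -> A), forall i j,
    cuts (enum_val j) (enum_val i).1 (enum_val i).2 -> N i j = r i * t j.
Proof.
move=> suppN minN; have [rho rhoP] := Xranked.
have [s rs sT] := revext_enum [set: X].
have sX x : x \in s by rewrite sT inE.
have sE : [set x in s] = [set: X] by apply/setP=> x; rewrite !inE sX.
have sz : size s = #|X|.
  by rewrite -cardsT -sE cardsE; apply/esym/card_uniqP; case/andP: rs.
have [a0 e0] := edge_top [set: X].
have E0 : (a0, None) \in hasse by rewrite inE.
have F0 : set0 \in filters by rewrite inE; apply/upsetP; split=> [|x y]; rewrite ?sub0set ?inE.
pose M a b J := N (enum_rank_in E0 (a, b)) (enum_rank_in F0 J).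
have suppM a b J : edge [set: X] a b -> upset [set: X] J ->
    if cuts J a b then M a b J \is a GRing.unit else M a b J == 0.
  move=> e u; have := suppN (enum_rank_in E0 (a, b)) (enum_rank_in F0 J).
  by rewrite !enum_rankK_in ?inE.
have [r [t H]] : exists r t, forall a b J, edge [set x in s] a b ->
    upset [set x in s] J -> cuts J a b -> M a b J = r a b * t J.
  apply: (slack_factorization width2 rhoP rs) => //.
    by move=> a b J; rewrite sE => e u; exact: suppM.
  have [e eP] := flag_rows rs sX.
  pose K (l : 'I_(size s).+1) := [set x in take l s].
  have uK l : upset [set: X] (K l).
    by rewrite -sE; apply: flag_upset => //; rewrite flagE; apply/mapP; exists (val l); rewrite ?mem_iota /=.
  pose f (l : 'I_(size s).+1) := enum_rank_in E0 (e l).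
  pose g (l : 'I_(size s).+1) := enum_rank_in F0 (K l).
  have NE l l' : N (f l) (g l') = M (e l).1 (e l).2 (K l').
    by rewrite /M -surjective_pairing.
  have du : \det (mxsub f g N) \is a GRing.unit.
    rewrite det_trig; last first.
      apply/is_trig_mxP=> l l' ll'; rewrite mxE NE; have [el cl] := eP l.
      have := suppM _ _ _ el (uK l'); rewrite cl ?(ltnW ll') //.
      by case: eqP => [E|_ /eqP//]; rewrite E ltnn in ll'.
    rewrite unitr_prod // => l _; rewrite mxE NE; have [el cl] := eP l.
    by have := suppM _ _ _ el (uK l); rewrite cl // eqxx.
  have mins f' g' : \det (mxsub f' g' N : 'M_((size s).+2)) = 0.
    by move: f' g'; rewrite sz; apply: minors_any.
  have bm := bordered_minors mins du.
  move=> J; rewrite sE => uJ; have [c Hc] := bm (enum_rank_in F0 J).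
  have us : uniq s by case/andP: rs.
  (* The flag has one member of each cardinality, so coefficients indexed by positions become
     coefficients indexed by filters. *)
  exists (fun B => c (inord #|B|)) => a b eab; rewrite /M Hc flagE big_map.
  rewrite -[iota 0 _]/(index_iota 0 (size s).+1) big_mkord; apply: eq_bigr => l _.
  rewrite -/(K l) -/(g l); congr (c _ * _).
  have -> : #|K l| = l.
    rewrite cardsE; have /card_uniqP -> : uniq (take l s) by exact: take_uniq.
    by rewrite size_takel // -ltnS.
  by rewrite inord_val.
exists (fun i => r (enum_val i).1 (enum_val i).2), (fun j => t (enum_val j)) => i j cu.
have := enum_valP i; rewrite inE => ei; have := enum_valP j; rewrite inE => uj.
have := H _ _ _ _ _ cu; rewrite sE => <- //.
by rewrite /M -surjective_pairing !enum_valK_in.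
Qed.

End Scaling.

End FlagMinor.

Arguments hasse {disp} X.
Arguments filters {disp} X.

(** * The cycle ideal is a toric ideal *)

Section Ideals.
Variables (A : comNzRingType) (G : classical_sets.set A).
Local Notation I := (ideal_gen G).

Lemma ideal_gen0 : I 0.
Proof. by exists [::]; rewrite ?big_nil. Qed.

Lemma ideal_genD p q : I p -> I q -> I (p + q).
Proof.
move=> [s sG ->] [t tG ->]; exists (s ++ t); rewrite ?big_cat //.
by move=> u; rewrite mem_cat => /orP[/sG|/tG].
Qed.

Lemma ideal_genM a p : I p -> I (a * p).
Proof.
move=> [s sG ->]; exists [seq (a * u.1, u.2) | u <- s].
  by move=> u /mapP[v /sG ? ->].
by rewrite big_map mulr_sumr; apply: eq_bigr => u _; rewrite mulrA.
Qed.

Lemma ideal_gen_mem p : G p -> I p.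
Proof.
move=> Gp; exists [:: (1, p)]; last by rewrite big_seq1 mul1r.
by move=> u; rewrite inE => /eqP ->.
Qed.

Lemma ideal_gen_sum (J : Type) (r : seq J) (P : pred J) (F : J -> A) :
  (forall i, P i -> I (F i)) -> I (\sum_(i <- r | P i) F i).
Proof. by move=> H; elim/big_ind: _ => //; [exact: ideal_gen0|exact: ideal_genD]. Qed.

End Ideals.

Section CycleIdeal.
Variables (R : realType) (m n : nat) (S : 'M[R]_(m, n)).
Implicit Types (c s : seq ('I_m * 'I_n)) (e : 'I_m * 'I_n) (a : 'I_m).

Local Notation T := (cycle_ideal S).
Local Notation x := (symbolic S).

Lemma cycle_idealD p q : T p -> T q -> T (p + q). Proof. exact: ideal_genD. Qed.
Lemma cycle_idealM p q : T q -> T (p * q). Proof. exact: ideal_genM. Qed.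

(* A list of edges (i_1, j_1), ..., (i_k, j_k) stands for the walk
   i_1 j_1 i_2 j_2 ... i_k j_k a in the non-incidence graph; walk_out and
   walk_back are the products of the labels of its two kinds of edges. *)
Definition walk_out c := \prod_(e <- c) x e.1 e.2.

Fixpoint walk_back c a :=
  if c is e :: c' then x (if c' is e' :: _ then e'.1 else a) e.2 * walk_back c' a
  else 1.

Fixpoint walk_ok c a :=
  if c is e :: c' then
    [&& S e.1 e.2 != 0, S (if c' is e' :: _ then e'.1 else a) e.2 != 0 & walk_ok c' a]
  else true.

Lemma walk_out_cat c1 c2 : walk_out (c1 ++ c2) = walk_out c1 * walk_out c2.
Proof. exact: big_cat. Qed.

Lemma walk_back_cat c1 e c2 a :
  walk_back (c1 ++ e :: c2) a = walk_back c1 e.1 * walk_back (e :: c2) a.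
Proof.
elim: c1 => [|e1 c1 IH]; first by rewrite mul1r.
by rewrite cat_cons [LHS]/= IH [walk_back (_ :: c1) _]/= -mulrA; case: c1 {IH}.
Qed.

Lemma walk_back_rcons c e a : walk_back (rcons c e) a = walk_back c e.1 * x a e.2.
Proof. by rewrite -cats1 walk_back_cat /= mulr1. Qed.

Lemma walk_ok_cat c1 e c2 a :
  walk_ok (c1 ++ e :: c2) a = walk_ok c1 e.1 && walk_ok (e :: c2) a.
Proof.
elim: c1 => [|e1 c1 IH] //.
by rewrite cat_cons [LHS]/= IH [walk_ok (_ :: c1) _]/= -!andbA; case: c1 {IH}.
Qed.

Lemma walk_ok_rcons c e a :
  walk_ok (rcons c e) a = [&& walk_ok c e.1, S e.1 e.2 != 0 & S a e.2 != 0].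
Proof. by rewrite -cats1 walk_ok_cat /= andbT. Qed.

(* With c the label of the chord and P_i, Q_i the two products of the i-th half:
   P_1 P_2 - Q_1 Q_2 = P_2 (P_1 - Q_1 c) + Q_1 (c P_2 - Q_2). *)
Lemma chord_split e0 c1 e1 e2 c2 :
  walk_ok (e0 :: c1 ++ e1 :: e2 :: c2) e0.1 -> S e0.1 e1.2 != 0 ->
  (forall e c, (size c < (size c1 + size c2).+2)%N -> walk_ok (e :: c) e.1 ->
     T (walk_out (e :: c) - walk_back (e :: c) e.1)) ->
  T (walk_out (e0 :: c1 ++ e1 :: e2 :: c2) - walk_back (e0 :: c1 ++ e1 :: e2 :: c2) e0.1).
Proof.
move=> ok chord IH.
have [[ok1 ok2] [ok3 ok4 ok5]] : [/\ walk_ok (e0 :: c1) e1.1 & S e1.1 e1.2 != 0] /\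
    [/\ S e2.1 e1.2 != 0, S e2.1 e2.2 != 0 & walk_ok (e2 :: c2) e0.1].
  move: ok; rewrite -cat_cons walk_ok_cat => /andP[-> /=].
  by case/and3P=> -> -> /and3P[-> -> ->].
have T1 : T (walk_out (e0 :: rcons c1 e1) - walk_back (e0 :: rcons c1 e1) e0.1).
  apply: IH; first by rewrite size_rcons !ltnS leq_addr.
  by rewrite -rcons_cons walk_ok_rcons ok1 ok2.
have T2 : T (walk_out ((e0.1, e1.2) :: e2 :: c2) - walk_back ((e0.1, e1.2) :: e2 :: c2) e0.1).
  apply: (IH (e0.1, e1.2)); first by rewrite /= !ltnS leq_addl.
  by rewrite [walk_ok _ _]/= chord ok3.
move: T1 T2; rewrite -rcons_cons walk_back_rcons [walk_back (_ :: e2 :: _) _]/=.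
rewrite -cat_cons walk_back_cat [walk_back (e1 :: _) _]/= walk_out_cat -cats1 walk_out_cat.
rewrite /walk_out !big_cons !big_nil !mulr1.
set P1 := _ * \prod_(e <- c1) _; set B := walk_back (e0 :: c1) _; rewrite /=; set Q := _ * walk_back c2 _.
set P2 := _ * \prod_(e <- c2) _ => T1 T2.
have := cycle_idealD (cycle_idealM P2 T1) (cycle_idealM B T2).
by congr T; ring.
Qed.

Lemma walk_out_rot k c : walk_out (rot k c) = walk_out c.
Proof. by apply: perm_big; rewrite perm_rot. Qed.

Lemma walk_back_rot1 e c : walk_back (rot 1 (e :: c)) (head e (rot 1 (e :: c))).1 =
  walk_back (e :: c) e.1.
Proof.
rewrite rot1_cons; case: c => [|e' c] //.
by rewrite walk_back_rcons [RHS]/= mulrC.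
Qed.

Lemma walk_ok_rot1 e c : walk_ok (rot 1 (e :: c)) (head e (rot 1 (e :: c))).1 =
  walk_ok (e :: c) e.1.
Proof.
rewrite rot1_cons; case: c => [|e' c] //.
by rewrite walk_ok_rcons [RHS]/= [RHS]andbA andbC.
Qed.

Lemma closed_walk_rot k e c : exists e' c', [/\ rot k (e :: c) = e' :: c',
  walk_back (e' :: c') e'.1 = walk_back (e :: c) e.1
  & walk_ok (e' :: c') e'.1 = walk_ok (e :: c) e.1].
Proof.
elim: k => [|k [e' [c' [E1 E2 E3]]]]; first by exists e, c; rewrite rot0.
have [kc|kc] := ltnP k (size (e :: c)); last first.
  by exists e, c; rewrite rot_oversize // (leq_trans kc).
rewrite -add1n rotD ?add1n // E1 -E2 -E3 -walk_back_rot1 -walk_ok_rot1.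
by case E: (rot 1 (e' :: c')) => [|f d]; [move/(congr1 size): E; rewrite size_rot|exists f, d].
Qed.

Lemma walk_back_nth e0 c a : walk_back c a =
  \prod_(0 <= l < size c) x (if (l.+1 < size c)%N then (nth e0 c l.+1).1 else a) (nth e0 c l).2.
Proof.
elim: c => [|e c IH]; first by rewrite big_nil.
by rewrite big_nat_recl // [LHS]/= IH; case: c {IH} => [|e1 c].
Qed.

Lemma walk_ok_nth e0 c a l : walk_ok c a -> (l < size c)%N ->
  S (nth e0 c l).1 (nth e0 c l).2 != 0 /\
  S (if (l.+1 < size c)%N then (nth e0 c l.+1).1 else a) (nth e0 c l).2 != 0.
Proof.
elim: c l => [|e c IH] // [|l] /= /and3P[h1 h2 h3] lc; last exact: IH.
by split=> //; case: c {IH h3 lc} h2.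
Qed.

Definition walk_nodes c : seq ('I_m + 'I_n) := flatten [seq [:: inl e.1; inr e.2] | e <- c].

Lemma size_walk_nodes c : size (walk_nodes c) = (size c).*2.
Proof. by elim: c => //= e c ->. Qed.

Lemma nth_walk_nodes v e0 c l : (l < size c)%N ->
  nth v (walk_nodes c) l.*2 = inl (nth e0 c l).1 /\
  nth v (walk_nodes c) l.*2.+1 = inr (nth e0 c l).2.
Proof. by elim: c l => [|e c IH] // [|l] //= /IH. Qed.

Lemma mem_walk_nodes c v :
  (v \in walk_nodes c) = match v with inl i => i \in unzip1 c | inr j => j \in unzip2 c end.
Proof. by elim: c => [|e c IH]; [case: v|rewrite !inE IH; case: v {IH} => i /=; rewrite !inE]. Qed.

Lemma uniq_walk_nodes c : uniq (walk_nodes c) = uniq (unzip1 c) && uniq (unzip2 c).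
Proof.
elim: c => //= e c ->; rewrite inE !mem_walk_nodes /=.
by case: (_ \in _); case: (_ \in _); rewrite //= ?andbF.
Qed.

Lemma next_nth_mod (V : eqType) (p : seq V) v l : uniq p -> (l < size p)%N ->
  next p (nth v p l) = nth v p (l.+1 %% size p).
Proof.
case: p => [|y p] // up lp; rewrite next_nth mem_nth // index_uniq //.
move: lp; rewrite ltnS leq_eqVlt => /orP[/eqP ->|lp].
  by rewrite modnn nth_default.
by rewrite modn_small //= (set_nth_default v).
Qed.

Lemma walk_nodes_next e0 c l : uniq (walk_nodes c) -> (l < size c)%N ->
  next (walk_nodes c) (inl (nth e0 c l).1) = inr (nth e0 c l).2 /\
  next (walk_nodes c) (inr (nth e0 c l).2) =
    inl (if (l.+1 < size c)%N then (nth e0 c l.+1).1 else (head e0 c).1).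
Proof.
move=> u lc; pose v : 'I_m + 'I_n := inl e0.1.
have [E1 E2] := nth_walk_nodes v e0 lc.
have l1 : (l.*2 < size (walk_nodes c))%N by rewrite size_walk_nodes ltn_double.
have l2 : (l.*2.+1 < size (walk_nodes c))%N by rewrite size_walk_nodes ltn_Sdouble.
split; first by rewrite -E1 next_nth_mod // modn_small.
rewrite -{1}E2 next_nth_mod // size_walk_nodes -doubleS.
case: ltnP => h; last first.
  have -> : size c = l.+1 by apply/eqP; rewrite eqn_leq h lc.
  rewrite modnn; have c0 : (0 < size c)%N by apply: leq_trans lc.
  by have [-> _] := nth_walk_nodes v e0 c0; rewrite nth0.
by rewrite modn_small ?ltn_double //; have [-> _] := nth_walk_nodes v e0 h.
Qed.

(** The nodes are distinct, so they form a cycle; the last hypothesis says that the only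
    non-incidences among them are its own edges. The difference is then a generator. *)
Lemma chordless_walk e0 c : (1 < size c)%N -> walk_ok c (head e0 c).1 ->
  uniq (unzip1 c) -> uniq (unzip2 c) ->
  (forall l l', (l < size c)%N -> (l' < size c)%N ->
     S (nth e0 c l).1 (nth e0 c l').2 != 0 -> l' = l \/ l = (l'.+1 %% size c)%N) ->
  T (walk_out c - walk_back c (head e0 c).1).
Proof.
move=> c1 ok u1 u2 nochord.
have u : uniq (walk_nodes c) by rewrite uniq_walk_nodes u1.
have nx l (lc : (l < size c)%N) := walk_nodes_next e0 u lc.
have okn l (lc : (l < size c)%N) := walk_ok_nth e0 ok lc.
have rowP i : inl i \in walk_nodes c -> exists2 l, (l < size c)%N & i = (nth e0 c l).1.
  rewrite mem_walk_nodes => /(nthP e0.1)[l]; rewrite size_map => lc <-.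
  by exists l; rewrite // (nth_map e0).
have colP j : inr j \in walk_nodes c -> exists2 l, (l < size c)%N & j = (nth e0 c l).2.
  rewrite mem_walk_nodes => /(nthP e0.2)[l]; rewrite size_map => lc <-.
  by exists l; rewrite // (nth_map e0).
have adj i j : inl i \in walk_nodes c -> inr j \in walk_nodes c -> S i j != 0 ->
    inr j = next (walk_nodes c) (inl i) \/ inl i = next (walk_nodes c) (inr j).
  move=> /rowP[l lc ->] /colP[l' lc' ->] /(nochord _ _ lc lc')[->|E].
    by left; case: (nx l lc).
  right; case: (nx l' lc') => _ ->; congr inl; move: lc'; rewrite leq_eqVlt E.
  by case: eqP => [-> _|_ /= lc']; rewrite ?ltnn ?modnn ?nth0 // modn_small // lc'.
apply: ideal_gen_mem; exists (walk_nodes c).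
  split; first by rewrite size_walk_nodes; case: (size c) c1 => [|[|k]].
  - rewrite /ucycle u andbT; apply: cycle_from_next => // -[i /rowP|j /colP] [l lc ->].
      by case: (nx l lc) (okn l lc) => -> _ [].
    case: (nx l lc) (okn l lc) => _ ->; case: ltnP => //= lc'; first by case.
    by case.
  - move=> [i|j] [i'|j'] //= av bv ab; first exact: adj.
    by case: (adj _ _ bv av ab); [right|left].
rewrite /cycle_binomial -/(walk_nodes c); congr (_ - _).
  rewrite {2}/walk_nodes big_flatten big_map; apply: eq_big_seq => e /(nthP e0)[l lc <-].
  by rewrite !big_cons big_nil /= mulr1; case: (nx l lc) => ->.
rewrite {2}/walk_nodes big_flatten big_map (walk_back_nth e0) (big_nth e0).
apply: eq_big_nat => l /= lc; rewrite !big_cons big_nil /= mulr1.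
by case: (nx l lc) => _ ->.
Qed.

Lemma closed_walk e c : walk_ok (e :: c) e.1 ->
  T (walk_out (e :: c) - walk_back (e :: c) e.1).
Proof.
have [k] := ubnP (size c); elim: k e c => // k IH e c; rewrite ltnS => le_k ok.
pose p := e :: c; have sp : size p = (size c).+1 by [].
have tr q : q = 0 -> T q by move=> ->; exact: ideal_gen0.
case: c le_k ok @p sp => [|f c] le_k ok p sp.
  by apply: tr; rewrite /walk_out big_seq1 /= mulr1 subrr.
case: c le_k ok @p sp => [|g c] le_k ok p sp.
  (* With two rows and two columns the binomial is 0 if a node repeats, and otherwise belongs to a
     quadrilateral, which has no room for a chord. *)
  have [r12|r12] := eqVneq e.1 f.1.
    by apply: tr; rewrite /walk_out big_cons big_seq1 /= r12 mulr1 subrr.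
  have [c12|c12] := eqVneq e.2 f.2.
    by apply: tr; rewrite /walk_out big_cons big_seq1 /= c12 mulr1 mulrC subrr.
  apply: (@chordless_walk e) => //; rewrite /= ?inE ?andbT //.
  by move=> [|[|l]] [|[|l']] //= _ _ _; [left|right|right|left].
set c3 := g :: c in le_k ok p sp.
have rotT l e0 c1 e1 c2 : rot l p = e0 :: c1 ++ e1 :: c2 -> (0 < size c2)%N ->
    S e0.1 e1.2 != 0 -> T (walk_out p - walk_back p e.1).
  case: c2 => // e2 c2 E _ chord.
  have [e' [c' [E1 E2 E3]]] := closed_walk_rot l e (f :: c3).
  rewrite -(walk_out_rot l) -E2; move: E1 E3; rewrite -/p E => -[<- <-] ok'.
  rewrite /= -/p; apply: chord_split => //; first by rewrite ok'.
  move=> e3 c4 lt_c4; apply: IH; apply: leq_trans le_k; apply: leq_trans lt_c4 _.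
  by have := congr1 size E; rewrite size_rot sp /= size_cat /=; lia.
(* A chord from row l to column l' is neither of the two walk edges at that column; the walk is
   rotated to start at row l and then split. *)
case: (boolP [exists l : 'I_(size p), exists l' : 'I_(size p),
    [&& S (nth e p l).1 (nth e p l').2 != 0, l' != l & (val l != l'.+1 %% size p)%N]]).
  case/existsP=> -[l lp] /existsP[[l' lp'] /= /and3P[Sll l'l ll']].
  have {l'l} : l' != l by [].
  rewrite neq_ltn => /orP[l'l|l'l].
    have E2 : rot l p = nth e p l :: (drop l.+1 p ++ take l' p) ++ nth e p l' :: take (l - l').-1 (drop l'.+1 p).
      rewrite /rot (drop_nth e lp) cat_cons -catA; congr (_ :: _ ++ _).
      have -> : take l p = take (l' + (l - l').-1.+1) p by congr take; lia.
      by rewrite takeD (drop_nth e lp').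
    apply: rotT E2 _ Sll; rewrite size_take size_drop.
    have E3 : (l'.+1 %% size p = l'.+1)%N by apply: modn_small; lia.
    by move: ll'; rewrite E3; case: ifP; lia.
  have E2 : rot l p = nth e p l :: take (l' - l.+1) (drop l.+1 p) ++ nth e p l' :: (drop l'.+1 p ++ take l p).
    rewrite /rot (drop_nth e lp) cat_cons; congr (_ :: _).
    rewrite -{1}(cat_take_drop (l' - l.+1) (drop l.+1 p)) drop_drop subnK //.
    by rewrite (drop_nth e lp') -catA.
  apply: rotT E2 _ Sll; rewrite size_cat size_take size_drop lp.
  case: (ltnP l'.+1 (size p)) => h; first lia.
  move: ll'; have -> : l'.+1 = size p by lia.
  by rewrite modnn; lia.
move=> /existsPn nc.
have nochord l l' : (l < size p)%N -> (l' < size p)%N ->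
     S (nth e p l).1 (nth e p l').2 != 0 -> l' = l \/ l = (l'.+1 %% size p)%N.
  move=> lp l'p Sll; have /existsPn/(_ (Ordinal l'p)) := nc (Ordinal lp).
  by rewrite Sll /= negb_and !negbK => /orP[/eqP[]|/eqP]; [left|right].
have okn l (lp : (l < size p)%N) := walk_ok_nth e ok lp.
have step l l' : (l < size p)%N -> (l' < size p)%N ->
    l = (l'.+1 %% size p)%N -> l' = (l.+1 %% size p)%N -> l = l'.
  move=> lp lp'.
  have [h|h] := ltnP l'.+1 (size p); have [h'|h'] := ltnP l.+1 (size p).
  - by rewrite !modn_small //; lia.
  - have -> : l.+1 = size p by lia.
    by rewrite modnn modn_small //; rewrite sp /= in lp lp' h h' *; lia.
  - have -> : l'.+1 = size p by lia.
    by rewrite modnn modn_small //; rewrite sp /= in lp lp' h h' *; lia.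
  - by lia.
(* A row or column occurring twice would give a chord unless each of its two positions cyclically
   follows the other, which is impossible for length at least three. *)
apply: (@chordless_walk e) => //; [apply/(uniqP e.1)|apply/(uniqP e.2)] => l l';
  rewrite !inE size_map => lp lp'; rewrite !(nth_map e) // => E.
- have [S1 _] := okn _ lp; have [S2 _] := okn _ lp'.
  have [//|H1] : l' = l \/ l = (l'.+1 %% size p)%N by apply: nochord; rewrite // E.
  have [//|H2] : l = l' \/ l' = (l.+1 %% size p)%N by apply: nochord; rewrite // -E.
  exact: step.
- have [S1 _] := okn _ lp; have [S2 _] := okn _ lp'.
  have [//|H1] : l' = l \/ l = (l'.+1 %% size p)%N by apply: nochord; rewrite // -E.
  have [//|H2] : l = l' \/ l' = (l.+1 %% size p)%N by apply: nochord; rewrite // E.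
  exact: step.
Qed.

Definition edges_ok s := all (fun e => S e.1 e.2 != 0) s.

(* The symmetric difference of s and s' decomposes into closed walks
   alternating between s and s'; the walk c' e is the part of the current one
   that has been followed so far. *)
Lemma open_walk s s' c e :
  walk_ok c e.1 -> S e.1 e.2 != 0 -> edges_ok s -> edges_ok s' ->
  perm_eq ((head e c).1 :: unzip1 s) (unzip1 s') ->
  perm_eq (e.2 :: unzip2 s) (unzip2 s') ->
  T (walk_out (rcons c e) * walk_out s - walk_back c e.1 * walk_out s').
Proof.
have [k] := ubnP (size s'); elim: k s s' c e => // k IH s s' c e.
rewrite ltnS => le_k okc oke oks oks' p1 p2.
have : e.2 \in unzip2 s' by rewrite -(perm_mem p2) inE eqxx.
case/mapP=> f fs' ef; have ps' := perm_to_rem fs'.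
set s2 := rem f s' in ps'.
have ws' : walk_out s' = x f.1 e.2 * walk_out s2.
  by rewrite /walk_out (perm_big _ ps') big_cons /= ef.
have szs' : size s' = (size s2).+1 by rewrite (perm_size ps').
have oks2 : edges_ok s2 by apply/allP=> g /mem_rem; move/allP: oks'; apply.
have okf : S f.1 e.2 != 0 by rewrite ef; move/allP: oks' => /(_ _ fs').
have q1 : perm_eq ((head e c).1 :: unzip1 s) (f.1 :: unzip1 s2).
  by apply: perm_trans p1 (perm_map _ ps').
have q2 : perm_eq (unzip2 s) (unzip2 s2).
  by rewrite -(perm_cons e.2); apply: perm_trans p2 _; rewrite ef; apply: (perm_map _ ps').
(* If f leads back to the starting row, a closed walk splits off and the remaining edges again have
   equal degrees. Otherwise row f.1 still has an edge in s, along which the walk goes on. *)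
have [fa|fa] := eqVneq f.1 (head e c).1.
  rewrite fa perm_cons in q1; rewrite ws'.
  have T1 : T (walk_out s - walk_out s2).
    case: s {p1 p2} oks q1 q2 => [|g s] oks q1 q2.
      case: (s2) q1 => [|h t] q1; first by rewrite subrr; exact: ideal_gen0.
      by move/perm_size: q1.
    case/andP: oks => okg oks.
    have := IH s s2 [::] g _ isT okg oks oks2 q1 q2; rewrite -szs' => /(_ le_k).
    by rewrite [rcons _ _]/= mul1r /walk_out big_seq1 big_cons.
  have T2 : T (walk_out (rcons c e) - walk_back (rcons c e) (head e c).1).
    have ok2 : walk_ok (rcons c e) (head e c).1 by rewrite walk_ok_rcons okc oke -fa.
    by case: (c) ok2 => [|h t] ok2; apply: closed_walk.
  have := cycle_idealD (cycle_idealM (walk_out s) T2)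
            (cycle_idealM (walk_back (rcons c e) (head e c).1) T1).
  by rewrite walk_back_rcons fa; congr T; ring.
have : f.1 \in unzip1 s.
  by have := perm_mem q1 f.1; rewrite !inE eqxx (negPf fa).
case/mapP=> g gs fg; have ps := perm_to_rem gs; set s1 := rem g s in ps.
have ws : walk_out s = x g.1 g.2 * walk_out s1.
  by rewrite /walk_out (perm_big _ ps) big_cons.
have okg : S g.1 g.2 != 0 by move/allP: oks => /(_ _ gs).
have oks1 : edges_ok s1 by apply/allP=> h /mem_rem; move/allP: oks; apply.
have okc2 : walk_ok (rcons c e) g.1 by rewrite walk_ok_rcons okc oke -fg.
have r1 : perm_eq ((head g (rcons c e)).1 :: unzip1 s1) (unzip1 s2).
  rewrite -(perm_cons f.1) -(permPr q1) perm_sym.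
  rewrite (_ : head g (rcons c e) = head e c); last by case: (c).
  have : perm_eq (unzip1 s) (f.1 :: unzip1 s1) by rewrite fg; apply: (perm_map _ ps).
  rewrite -(perm_cons (head e c).1) => /permPl ->.
  by apply/permPl; apply: (perm_catCA [:: _] [:: _]).
have r2 : perm_eq (g.2 :: unzip2 s1) (unzip2 s2).
  by apply: perm_trans q2; rewrite perm_sym; apply: (perm_map _ ps).
have := IH s1 s2 (rcons c e) g _ okc2 okg oks1 oks2 r1 r2; rewrite -szs' => /(_ le_k).
rewrite walk_back_rcons -fg ws ws' -[rcons (rcons _ _) _]cats1 walk_out_cat.
rewrite [walk_out [:: g]]/walk_out big_seq1 fg; congr T; ring.
Qed.

Lemma same_degrees s s' : edges_ok s -> edges_ok s' ->
  perm_eq (unzip1 s) (unzip1 s') -> perm_eq (unzip2 s) (unzip2 s') ->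
  T (walk_out s - walk_out s').
Proof.
case: s => [|e s] oks oks' p1 p2.
  case: s' p1 {oks' p2} => [|e s']; first by rewrite subrr => _; exact: ideal_gen0.
  by move/perm_size.
case/andP: oks => oke oks.
have := @open_walk s s' [::] e isT oke oks oks' p1 p2.
by rewrite [rcons _ _]/= mul1r /walk_out big_seq1 big_cons.
Qed.

(** * Monomials under the substitution x_ij = r_i t_j *)

Local Notation k := (nvars S).
Local Notation pos t := (enum_val t : 'I_m * 'I_n).

Lemma symbolic_val (t : 'I_k) : x (pos t).1 (pos t).2 = 'X_t.
Proof.
rewrite mxE; case: pickP => [t' /eqP|/(_ t)]; last by rewrite -surjective_pairing eqxx.
by rewrite -surjective_pairing => /enum_val_inj ->.
Qed.

Lemma symbolic_eq0 i j : S i j = 0 -> x i j = 0.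
Proof.
move=> Sij; rewrite mxE; case: pickP => // t /eqP E.
by have := enum_valP t; rewrite E inE /= Sij eqxx.
Qed.

Definition monomial_edges (u : 'X_{1..k}) : seq ('I_m * 'I_n) :=
  flatten [seq nseq (u t) (pos t) | t <- enum 'I_k].

Lemma walk_out_monomial u : walk_out (monomial_edges u) = 'X_[u].
Proof.
rewrite mpolyXE_id /walk_out big_flatten big_map big_enum.
by apply: eq_bigr => t _; rewrite big_nseq iter_mulr_1 symbolic_val.
Qed.

Lemma edges_ok_monomial u : edges_ok (monomial_edges u).
Proof.
apply/allP=> e /flattenP[s /mapP[t _ ->]]; rewrite mem_nseq => /andP[_ /eqP->].
by have := enum_valP t; rewrite inE.
Qed.

Definition toric_vars : k.-tuple {mpoly R[m + n]} :=
  [tuple 'X_(lshift n (pos t).1) * 'X_(rshift m (pos t).2) | t < k].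

Definition toric_deg (u : 'X_{1..k}) : 'X_{1..m + n} :=
  (\sum_(t < k) (U_(lshift n (pos t).1) + U_(rshift m (pos t).2)) *+ u t)%MM.

Lemma toricX u : 'X_[u] \mPo toric_vars = 'X_[toric_deg u].
Proof.
rewrite comp_mpolyX /toric_deg -mprodXE; apply: eq_bigr => t _.
by rewrite tnth_mktuple -mpolyXD mpolyXn.
Qed.

Lemma count_monomial u (a : pred ('I_m * 'I_n)) :
  count a (monomial_edges u) = (\sum_(t < k) a (pos t) * u t)%N.
Proof.
rewrite count_flatten -map_comp sumnE big_map big_enum.
by apply: eq_bigr => t _ /=; rewrite count_nseq.
Qed.

Lemma toric_degE u : 
  (forall i, toric_deg u (lshift n i) = count_mem i (unzip1 (monomial_edges u))) /\
  (forall j, toric_deg u (rshift m j) = count_mem j (unzip2 (monomial_edges u))).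
Proof.
split=> i; rewrite mnm_sumE count_map count_monomial; apply: eq_bigr => t _ /=;
  rewrite mulmnE mnmDE !mnm1E.
- by rewrite (inj_eq (@lshift_inj _ _)) eq_rlshift addn0.
- by rewrite (inj_eq (@rshift_inj _ _)) eq_lrshift.
Qed.

Lemma same_toric_deg u v : toric_deg u = toric_deg v -> T ('X_[u] - 'X_[v]).
Proof.
move=> E; have [u1 u2] := toric_degE u; have [v1 v2] := toric_degE v.
rewrite -!walk_out_monomial; apply: same_degrees; rewrite ?edges_ok_monomial //.
- by apply/allP=> i _; rewrite /= -u1 -v1 E.
- by apply/allP=> i _; rewrite /= -u2 -v2 E.
Qed.

(** Monomials are grouped by their image. In each group the coefficients sum to 0, so subtracting a
    representative [G w] from every monomial of the group does not change p. *)
Lemma toric_kernel p : p \mPo toric_vars = 0 -> T p.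
Proof.
move=> p0; pose G w : {mpoly R[k]} := 'X_[head 0%MM [seq u <- msupp p | toric_deg u == w]].
have TG u : u \in msupp p -> T ('X_[u] - G (toric_deg u)).
  move=> up; apply: same_toric_deg; set s := [seq _ <- _ | _].
  have : u \in s by rewrite mem_filter eqxx.
  have : all (fun v => toric_deg v == toric_deg u) s by apply: filter_all.
  by case: s => //= v s /andP[/eqP-> _].
have -> : p = \sum_(u <- msupp p) p@_u *: ('X_[u] - G (toric_deg u)).
  rewrite {1}[p]mpolyE; apply/eqP; rewrite -subr_eq0 -sumrB; apply/eqP.
  under eq_bigr do rewrite -scalerBr opprB addrC subrK.
  pose ws := undup [seq toric_deg u | u <- msupp p].
  transitivity (\sum_(w <- ws) (p \mPo toric_vars)@_w *: G w); last first.
    by rewrite big1 // => w _; rewrite p0 mcoeff0 scale0r.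
  have E w : (p \mPo toric_vars)@_w = \sum_(u <- msupp p) p@_u * (toric_deg u == w)%:R.
    rewrite {1}[p]mpolyE (raddf_sum (comp_mpoly toric_vars)) (raddf_sum (mcoeff w)); apply: eq_bigr => u _ /=.
    by rewrite comp_mpolyZ toricX mcoeffZ mcoeffX.
  under [RHS]eq_bigr do rewrite E scaler_suml.
  rewrite [RHS]exchange_big; apply: eq_big_seq => u up /=.
  have uw : toric_deg u \in ws by rewrite mem_undup map_f.
  rewrite (bigD1_seq _ uw) ?undup_uniq //= eqxx mulr1 big1 ?addr0 // => w /negPf.
  by rewrite eq_sym => ->; rewrite mulr0 scale0r.
rewrite big_seq; apply: ideal_gen_sum => u /TG Tu.
by rewrite -mul_mpolyC; apply: cycle_idealM.
Qed.

(* Under the substitution x_ij = r_i t_j the symbolic slack matrix becomes a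
   rescaling of the 0/1 matrix S. *)
Lemma slack_sub_cycle d : (forall i j, S i j = (S i j != 0)%:R) ->
  (forall (f : 'I_d.+2 -> 'I_m) (g : 'I_d.+2 -> 'I_n), \det (mxsub f g S) = 0) -> forall p, slack_ideal d S p -> T p.
Proof.
move=> S01 rkS p [N [s sG E]]; apply: toric_kernel.
have XN0 : (\prod_(t < k) 'X_t) \mPo toric_vars != 0.
  rewrite rmorph_prod /=; apply/prodf_neq0 => t _.
  rewrite comp_mpolyXU -tnth_nth tnth_mktuple -mpolyXD; set w := (_ + _)%MM.
  by apply/eqP => /(congr1 (mcoeff w))/eqP; rewrite mcoeffX eqxx mcoeff0 oner_eq0.
have : ((\prod_(t < k) 'X_t) ^+ N * p) \mPo toric_vars = 0.
  rewrite E rmorph_sum /= big_seq big1 // => u /sG /= [f [g [_ _ ->]]].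
  rewrite rmorphM /= -det_map_mx.
  have -> : map_mx (comp_mpoly toric_vars) (mxsub f g x) =
     diag_mx (\row_a 'X_(lshift n (f a))) *m map_mx (@mpolyC _ R) (mxsub f g S)
       *m diag_mx (\row_b 'X_(rshift m (g b))).
    apply/matrixP=> a b; rewrite mul_mx_diag mxE mul_diag_mx !mxE.
    rewrite (S01 (f a) (g b)); case: pickP => [t /eqP tab|nt].
      have := enum_valP t; rewrite inE tab /= => ->.
      by rewrite comp_mpolyXU -tnth_nth tnth_mktuple tab /= mulr1.
    rewrite raddf0; case: (boolP (S (f a) (g b) != 0)) => Sab; last by rewrite mulr0 mul0r.
    have abS : (f a, g b) \in support_mx S by rewrite inE.
    by have := nt (enum_rank_in abS (f a, g b)); rewrite enum_rankK_in // eqxx.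
  by rewrite !det_mulmx det_map_mx rkS rmorph0 mulr0 mul0r mulr0.
(* The polynomial ring in r and t is a domain and the product of the variables has nonzero image, so
   the saturating power cancels. *)
rewrite rmorphM rmorphXn /= => /eqP; rewrite mulf_eq0 expf_eq0 (negPf XN0) andbF /=.
by move/eqP.
Qed.

End CycleIdeal.
(** * Cycle binomials lie in the slack ideal *)

Local Open Scope quotient_scope.

Lemma classical_quotient (A : comNzRingType) (I : A -> Prop) :
  I 0 -> ~ I 1 -> (forall a u v, I u -> I v -> I (a * u + v)) ->
  exists (B : comNzRingType) (f : {rmorphism A -> B}), forall a, f a = 0 <-> I a.
Proof.
move=> I0 I1 IM; pose S : A -> bool := fun a => boolp.asbool (I a).
have Sc : idealr_closed S.
  split; first exact/boolp.asboolP.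
    by apply/negP => /boolp.asboolP.
  by move=> a u v /boolp.asboolP Iu /boolp.asboolP Iv; apply/boolp.asboolP; apply: IM.
pose J : idealr A := HB.pack S (isIdealr.Build A S Sc).
pose f : {rmorphism A -> {ideal_quot J}} := \pi_{ideal_quot J}.
exists {ideal_quot J}, f => a; rewrite -(rmorph0 f).
have -> : I a <-> a - 0 \in J by rewrite subr0; split=> [h|/boolp.asboolP//]; apply/boolp.asboolP.
by rewrite Quotient.idealrBE; split=> [->//|/eqP].
Qed.

(** The factorization needs a boolean unit predicate and an inverse function; classical choice
    supplies both on the same carrier. *)
Lemma classical_units (Q : comNzRingType) :
  exists (B : comUnitRingType) (f : {rmorphism Q -> B}), injective f.
Proof.
pose un : pred Q := fun x => boolp.asbool (exists y, y * x = 1).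
have invP (x : Q) : exists y, if un x then y * x = 1 else y = x.
  case E: (un x); last by exists x.
  by case/boolp.asboolP: E => y; exists y.
have [inv Hinv] := boolp.choice invP.
have h1 : {in un, left_inverse 1 inv *%R}.
  by move=> x ux; have := Hinv x; rewrite (ux : un x).
have h2 (x y : Q) : y * x = 1 -> un x by move=> yx; apply/boolp.asboolP; exists y.
have h3 : {in [predC un], inv =1 id}.
  by move=> x ux; have := Hinv x; rewrite (negPf (ux : ~~ un x)).
pose B : comUnitRingType :=
  HB.pack (GRing.ComNzRing.sort Q) (GRing.ComNzRing_hasMulInverse.Build Q h1 h2 h3).
pose f : {rmorphism Q -> Q} := idfun.
by exists B, f.
Qed.

(** * Localization by clearing denominators *)

Section Localization.
Variables (A : comNzRingType) (G : classical_sets.set A) (z : A).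
Implicit Types q : {poly A}.

(* z ^+ N * q.[1 / z] without division. *)
Definition homogenize N q := \sum_(i < N.+1) q`_i * z ^+ (N - i).

Lemma homogenizeS N q : (size q <= N.+1)%N -> homogenize N.+1 q = z * homogenize N q.
Proof.
move=> sq; rewrite /homogenize big_ord_recr /= [q`_N.+1]nth_default // mul0r addr0.
rewrite mulr_sumr; apply: eq_bigr => i _.
by rewrite mulrCA -exprS subSn // -ltnS.
Qed.

Lemma homogenizeMX N q : homogenize N.+1 (q * 'X) = homogenize N q.
Proof.
rewrite /homogenize big_ord_recl coefMX mul0r add0r.
by apply: eq_bigr => i _; rewrite coefMX /= subSS.
Qed.

(** The kernel of the map from A[X] to A[1/z] / (G) sending X to 1/z, described inside A. *)
Definition localized q := exists2 N, (size q <= N.+1)%N & ideal_gen G (homogenize N q).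

Lemma localized_leq q N M : (size q <= N.+1)%N -> (N <= M)%N ->
  ideal_gen G (homogenize N q) -> ideal_gen G (homogenize M q).
Proof.
move=> sq /subnKC <- H; elim: (M - N)%N => [|d IH]; first by rewrite addn0.
rewrite addnS homogenizeS ?(leq_trans sq) ?ltnS ?leq_addr //; exact: ideal_genM.
Qed.

Lemma localizedD p q : localized p -> localized q -> localized (p + q).
Proof.
move=> [N sp Hp] [M sq Hq]; exists (N + M)%N.
  rewrite (leq_trans (size_polyD _ _)) // geq_max.
  by rewrite (leq_trans sp) ?ltnS ?leq_addr // (leq_trans sq) // ltnS leq_addl.
have -> : homogenize (N + M) (p + q) = homogenize (N + M) p + homogenize (N + M) q.
  by rewrite -big_split; apply: eq_bigr => i _; rewrite coefD mulrDl.
apply: ideal_genD; first exact: localized_leq sp (leq_addr _ _) Hp.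
exact: localized_leq sq (leq_addl _ _) Hq.
Qed.

Lemma localizedM a q : localized q -> localized (a * q).
Proof.
move=> Hq; elim/poly_ind: a => [|a c IH].
  by rewrite mul0r; exists 0%N; rewrite ?size_poly0 // /homogenize big_ord1 coef0 mul0r; exact: ideal_gen0.
rewrite mulrDl; apply: localizedD.
  case: IH => N saq H; exists N.+1; last by rewrite mulrAC homogenizeMX.
  by rewrite mulrAC (leq_trans (size_polyMleq _ _)) // size_polyX addn2 /= ltnS.
case: Hq => N sq H; exists N.
  by rewrite mul_polyC (leq_trans (size_scale_leq _ _)).
have -> : homogenize N (c%:P * q) = c * homogenize N q; last exact: ideal_genM.
by rewrite mulr_sumr; apply: eq_bigr => i _; rewrite coefCM mulrA.
Qed.

Lemma localizedC c : localized c%:P <-> exists N, ideal_gen G (z ^+ N * c).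
Proof.
have E N : homogenize N c%:P = z ^+ N * c.
  rewrite /homogenize big_ord_recl coefC subn0 big1 ?addr0 1?mulrC // => i _.
  by rewrite coefC mul0r.
split=> [[N _]|[N H]]; first by rewrite E; exists N.
by exists N; rewrite ?E // (leq_trans (size_polyC_leq1 _)).
Qed.

Lemma localized_inverse : localized (z%:P * 'X - 1).
Proof.
exists 1%N; first by rewrite (leq_trans (size_polyD _ _)) //
    geq_max size_polyN size_poly1 mul_polyC (leq_trans (size_scale_leq _ _)) ?size_polyX.
rewrite /homogenize big_ord_recl big_ord1 !coefD !coefN coefMX coefC /= coefMX coefC !coef1 /=.
by rewrite add0r subr0 mulN1r expr1 expr0 mulr1 addNr; exact: ideal_gen0.
Qed.

(* B is A[1/z] / (G). *)
Lemma saturation_quotient : ~ (exists N, ideal_gen G (z ^+ N)) ->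
  exists (B : comUnitRingType) (f : {rmorphism A -> B}),
    f z \is a GRing.unit /\ forall a, f a = 0 <-> saturation (ideal_gen G) z a.
Proof.
move=> nz; have [|||Q [g0 g0P]] := @classical_quotient {poly A} localized.
- by rewrite -[0]/(0%:P); apply/localizedC; exists 0%N; rewrite mulr0; exact: ideal_gen0.
- by rewrite -[1]/(1%:P) => /localizedC[N]; rewrite mulr1 => H; apply: nz; exists N.
- by move=> a u v Hu Hv; apply/localizedD => //; apply: localizedM.
have [B [h hi]] := classical_units Q.
pose g : {rmorphism {poly A} -> B} := h \o g0.
have gP q : g q = 0 <-> localized q.
  by rewrite -g0P; split=> [/= E|/= ->]; [apply: hi; rewrite E rmorph0|rewrite rmorph0].
pose f : {rmorphism A -> B} := g \o polyC.
exists B, f; split.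
  apply/unitrPr; exists (g 'X); apply/eqP; rewrite -subr_eq0 -[f z]/(g z%:P).
  by rewrite -rmorphM -(rmorph1 g) -rmorphB; apply/eqP/gP; exact: localized_inverse.
by move=> a; rewrite (gP a%:P); exact: localizedC.
Qed.

End Localization.

Section CycleSlack.
Context {disp : Order.disp_t} {X : finPOrderType disp} {R : realType}.
Hypothesis width2 : forall x y z : X, (x >< y)%O -> (y >< z)%O -> (x >< z)%O -> False.
Hypothesis Xranked : ranked X.

Lemma perm_map_next (V : eqType) (c : seq V) : uniq c -> perm_eq (map (next c) c) c.
Proof.
move=> uc; have ni : injective (next c) := can_inj (prev_next uc).
apply: uniq_perm; rewrite ?map_inj_uniq // => v.
apply/mapP/idP => [[w wc ->]|vc]; first by rewrite mem_next.
by exists (prev c v); rewrite ?mem_prev ?next_prev.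
Qed.

Lemma cycle_sub_slack (S : 'M[R]_(#|hasse X|, #|filters X|)) :
  (forall i j, S i j = (cuts (enum_val j) (enum_val i).1 (enum_val i).2)%:R) ->
  forall p, cycle_ideal S p -> slack_ideal #|X| S p.
Proof.
move=> S01 p Cp; rewrite /slack_ideal; set G := classical_sets.mkset _; set z := \prod_(t < _) _.
(* If a power of z is in the ideal, the saturation is everything; otherwise the localized quotient
   is a nonzero ring. *)
case: (boolp.EM (exists N, ideal_gen G (z ^+ N))) => [[N H]|nz].
  by exists N; rewrite mulrC; apply: ideal_genM.
have [B [f [fz fP]]] := saturation_quotient nz.
pose N : 'M[B]_(#|hasse X|, #|filters X|) := map_mx f (symbolic S).
have fX (t : 'I_(nvars S)) : f 'X_t \is a GRing.unit.
  move: fz; rewrite /z (bigD1 t) //= rmorphM unitrM => /andP[] //.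
have suppN i j : let e := enum_val i in
    if cuts (enum_val j) e.1 e.2 then N i j \is a GRing.unit else N i j == 0.
  have := S01 i j; rewrite /= mxE; case: ifP => _ Sij; last by rewrite symbolic_eq0 ?rmorph0.
  have ijS : (i, j) \in support_mx S by rewrite inE Sij oner_eq0.
  by have := symbolic_val (enum_rank_in ijS (i, j)); rewrite enum_rankK_in //= => ->.
have minN q : is_minor #|X|.+2 N q -> q = 0.
  move=> [a [b [ha hb ->]]]; rewrite -map_mxsub det_map_mx; apply/fP; exists 0%N.
  by rewrite mul1r; apply: ideal_gen_mem; exists a, b.
have [r [t H]] := slack_scaling width2 Xranked suppN minN.
have fS i j : S i j != 0 -> f (symbolic S i j) = r i * t j.
  move=> Sij; rewrite -H ?mxE //; apply: contraNT Sij => /negPf cu.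
  by rewrite S01 cu.
apply/fP; case: Cp => s sG ->; rewrite rmorph_sum big_seq big1 // => u /sG[c [_ /andP[cyc uc] _] ->].
rewrite rmorphM rmorphB !rmorph_prod /=; apply/eqP; rewrite mulrC.
(* An edge label becomes the product of the values of g at its two ends, so each of the two products
   of a cycle becomes the product of g over all its nodes. *)
pose g (v : 'I_#|hasse X| + 'I_#|filters X|) := match v with inl i => r i | inr j => t j end.
have lab v : v \in c -> f (edge_label S v (next c v)) = g v * g (next c v).
  move/(next_cycle cyc); case: v (next c v) => [i|j] [i'|j'] //= /fS // ->.
  by rewrite mulrC.
have row_next v : v \in c -> is_row (next c v) = ~~ is_row v.
  by move/(next_cycle cyc); case: v (next c v) => [i|j] [i'|j'] //=.
have shift (P : pred ('I_#|hasse X| + 'I_#|filters X|)) :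
    \prod_(v <- c | P (next c v)) g (next c v) = \prod_(v <- c | P v) g v.
  by rewrite -[RHS](perm_big _ (perm_map_next uc)) big_map.
have L (P : pred ('I_#|hasse X| + 'I_#|filters X|)) :
    \prod_(v <- c | P v) f (edge_label S v (next c v)) =
    (\prod_(v <- c | P v) g v) * \prod_(v <- c | P v) g (next c v).
  by rewrite -big_split big_seq_cond [RHS]big_seq_cond; apply: eq_bigr => v /andP[/lab].
have LN : \prod_(v <- c | is_row v) g (next c v) = \prod_(v <- c | ~~ is_row v) g v.
  rewrite -shift big_seq_cond [RHS]big_seq_cond; apply: eq_bigl => v.
  by case vc: (v \in c); rewrite //= row_next // negbK.
have LR : \prod_(v <- c | ~~ is_row v) g (next c v) = \prod_(v <- c | is_row v) g v.
  rewrite -shift big_seq_cond [RHS]big_seq_cond; apply: eq_bigl => v.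
  by case vc: (v \in c); rewrite //= row_next.
by rewrite !L LN LR [X in _ - X]mulrC subrr mul0r.
Qed.

End CycleSlack.
(** * Facets and vertices of the order polytope *)

Section Affine.
Variables (R : realType) (d : nat).
Implicit Types (c : 'cV[R]_(1 + d)) (x : 'rV[R]_d).

Lemma affE c x : aff c x = c (lshift d 0) 0 + \sum_k x 0 k * c (rshift 1 k) 0.
Proof.
rewrite /aff /hpoint mxE big_split_ord big_ord1 row_mxEl mxE mul1r; congr (_ + _).
by apply: eq_bigr => k _; rewrite row_mxEr.
Qed.

Lemma hpoint_comb n (w : 'I_n -> R) (p : 'I_n -> 'rV[R]_d) : \sum_i w i = 1 ->
  hpoint (\sum_i w i *: p i) = \sum_i w i *: hpoint (p i).
Proof.
move=> w1; rewrite /hpoint.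
have -> : \sum_i w i *: row_mx 1%:M (p i) = row_mx (\sum_i w i *: 1%:M) (\sum_i w i *: p i).
  apply/rowP=> k; rewrite summxE; case: (splitP k) => k' kk'.
    have -> : k = lshift d k' by apply: val_inj.
    by rewrite row_mxEl summxE; apply: eq_bigr => i _; rewrite [LHS]mxE row_mxEl [RHS]mxE.
  have -> : k = rshift 1 k' by apply: val_inj.
  by rewrite row_mxEr summxE; apply: eq_bigr => i _; rewrite [LHS]mxE row_mxEr [RHS]mxE.
by rewrite -scaler_suml w1 scale1r.
Qed.

Lemma aff_comb c n (w : 'I_n -> R) (p : 'I_n -> 'rV[R]_d) : \sum_i w i = 1 ->
  aff c (\sum_i w i *: p i) = \sum_i w i * aff c (p i).
Proof.
move=> w1; rewrite /aff hpoint_comb // mulmx_suml summxE.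
by apply: eq_bigr => i _; rewrite -scalemxAl mxE.
Qed.

Lemma aff_comb2 c (s : R) x y : aff c ((1 - s) *: x + s *: y) = (1 - s) * aff c x + s * aff c y.
Proof.
pose w (i : 'I_2) := if i == 0 then 1 - s else s.
pose p (i : 'I_2) := if i == 0 then x else y.
have := @aff_comb c 2 w p; rewrite !big_ord_recl !big_ord0 /w /p /= !addr0.
by apply; rewrite subrK.
Qed.

Lemma row_free_rowsub (F : fieldType) m n p (V : 'M[F]_(m, n)) (f : 'I_p -> 'I_m) :
  injective f -> row_free V -> row_free (rowsub f V).
Proof.
move=> fi /row_freeP[C VC]; apply/row_freeP; exists (colsub f C).
apply/matrixP=> i j; transitivity ((V *m C) (f i) (f j)).
  by rewrite !mxE; apply: eq_bigr => k _; rewrite !mxE.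
by rewrite VC !mxE (inj_eq fi).
Qed.

Lemma hyperplane_unique m (B : 'M[R]_(m, 1 + d)) c c' :
  row_free B -> m = d -> B *m c = 0 -> B *m c' = 0 -> c' != 0 ->
  exists k, c = k *: c'.
Proof.
move=> rB md Bc Bc' c'0.
have K (y : 'cV[R]_(1 + d)) : B *m y = 0 -> (y^T <= kermx B^T)%MS.
  by move=> By; apply/sub_kermxP; rewrite -trmx_mul By trmx0.
have r1 : \rank (kermx B^T) = 1%N.
  by rewrite mxrank_ker mxrank_tr (eqP rB) md addnK.
have rc' : \rank c'^T = 1%N by rewrite rank_rV -(inj_eq trmx_inj) trmxK trmx0 c'0.
have sub : (c^T <= c'^T)%MS.
  apply: submx_trans (K _ Bc) _; have := mxrank_leqif_sup (K _ Bc').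
  by rewrite /Order.leif => -[_ <-]; rewrite r1 rc'.
have /sub_rVP[k E] := sub; exists k; apply: trmx_inj.
by rewrite E linearZ.
Qed.

Lemma affine_rank_hyperplane (S : classical_sets.set 'rV[R]_d) c m (A : 'M[R]_(m, d)) :
  c != 0 -> (forall x, S x -> aff c x = 0) ->
  (forall i, S (row i A)) -> row_free (\matrix_i hpoint (row i A)) -> (m <= d)%N.
Proof.
move=> c0 Sc SA rA; set B := \matrix_i _ in rA.
have Bc : B *m c = 0.
  apply/matrixP=> i j; rewrite !ord1 mxE [RHS]mxE -[RHS](Sc _ (SA i)) /aff mxE.
  by apply: eq_bigr => k _; rewrite mxE.
have := mulmx0_rank_max Bc; rewrite (eqP rA).
have -> : \rank c = 1%N by rewrite -mxrank_tr rank_rV -(inj_eq trmx_inj) trmxK trmx0 c0.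
by rewrite addn1 add1n.
Qed.

End Affine.

Section OrderPolytope.
Context {R : realType} {disp : Order.disp_t} {X : finPOrderType disp}.
Implicit Types (J K : {set X}) (a b : option X) (x y z : X) (t : 'rV[R]_#|X|).

Let crd t i := t 0 (enum_rank i).
Local Notation P := (order_polytope R X).

(** The affine function t_b - t_a, with t equal to 0 at the bottom and 1 at the top. *)
Definition facet_form a b : 'cV[R]_(1 + #|X|) :=
  col_mx (b == None)%:R%:M
    (\col_k ((b == Some (enum_val k))%:R - (a == Some (enum_val k))%:R)).

Definition filter_point J : 'rV[R]_#|X| := \row_k (enum_val k \in J)%:R.

Lemma crd_filter_point J i : crd (filter_point J) i = (i \in J)%:R.
Proof. by rewrite /crd mxE enum_rankK. Qed.

Lemma crd_inj t t' : (forall i, crd t i = crd t' i) -> t = t'.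
Proof. by move=> H; apply/rowP=> k; rewrite -(enum_valK k); exact: H. Qed.

Lemma mul_facet_form a b (z : 'rV[R]_(1 + #|X|)) (u := fun i => z 0 (rshift 1 (enum_rank i))) :
  (z *m facet_form a b) 0 0 = hi (z 0 (lshift #|X| 0)) u b - lo u a.
Proof.
rewrite mxE big_split_ord big_ord1 /facet_form col_mxEu mxE eqxx mulr1n /=.
under eq_bigr do rewrite col_mxEd mxE mulrBr.
rewrite sumrB addrA; congr (_ - _).
  case: b => [y|]; last by rewrite mulr1 big1 ?addr0 // => k _; rewrite mulr0.
  rewrite mulr0 add0r (bigD1 (enum_rank y)) //= enum_rankK eqxx mulr1 big1 ?addr0 // => k ky.
  by case: eqP => [[yk]|_]; [rewrite yk enum_valK eqxx in ky|rewrite mulr0].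
case: a => [y|]; last by rewrite big1 // => k _; rewrite mulr0.
rewrite (bigD1 (enum_rank y)) //= enum_rankK eqxx mulr1 big1 ?addr0 // => k ky.
by case: eqP => [[yk]|_]; [rewrite yk enum_valK eqxx in ky|rewrite mulr0].
Qed.

Lemma aff_facet_form a b t : aff (facet_form a b) t = hi 1 (crd t) b - lo (crd t) a.
Proof.
rewrite /aff mul_facet_form /hpoint row_mxEl mxE; congr (_ - _).
  by case: b => //= y; rewrite row_mxEr.
by case: a => //= x; rewrite row_mxEr.
Qed.

Lemma aff_facet_filter a b J : edge [set: X] a b -> upset [set: X] J ->
  aff (facet_form a b) (filter_point J) = (cuts J a b)%:R.
Proof.
move=> e u; rewrite aff_facet_form (cutsE _ u e); congr (_ - _).
  by case: (b) => //= y; rewrite crd_filter_point.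
by case: (a) => //= x; rewrite crd_filter_point.
Qed.

Lemma edge_chain (u : X -> R) U :
  (forall a b, edge [set: X] a b -> lo u a <= hi U u b) ->
  forall a b, olt a b -> lo u a <= hi U u b.
Proof.
move=> H a b; have [n] := ubnP #|[set z | olt a (Some z) && olt (Some z) b]|.
elim: n a b => // n IH a b; rewrite ltnS => le_n ab.
case: (pickP [pred z | olt a (Some z) && olt (Some z) b]) => [z /andP[az zb]|no].
  have sub (B : {set X}) : B \subset [set z | olt a (Some z) && olt (Some z) b] ->
      z \notin B -> (#|B| < n)%N.
    move=> sB zB; apply: leq_trans le_n; apply: proper_card; apply/properP.
    by split=> //; exists z; rewrite // inE az.
  apply: (@le_trans _ _ (u z)).
    apply: (IH a (Some z)) => //; apply: sub; last by rewrite inE /= ltxx andbF.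
    apply/subsetP=> w; rewrite !inE => /andP[-> wz] /=.
    exact: (@olt_trans _ _ (Some z) (Some w) b isT wz zb).
  apply: (IH (Some z) b) => //; apply: sub; last by rewrite inE /= ltxx.
  apply/subsetP=> w; rewrite !inE => /andP[zw ->]; rewrite andbT.
  exact: (@olt_trans _ _ (Some z) a (Some w) isT az zw).
apply: H; apply/edgeP; split=> //; [by case: (a) => //= x; rewrite inE|by case: (b) => //= y; rewrite inE|].
by move=> z _ az zb; move/negP: (no z); apply; apply/andP.
Qed.

Lemma order_polytopeP t :
  P t <-> forall a b, edge [set: X] a b -> 0 <= aff (facet_form a b) t.
Proof.
split=> [[t01 tm] a b /edgeP[_ _ ab _]|H].
  rewrite aff_facet_form subr_ge0; case: a b ab => [x|] [y|] //= ab.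
  - exact: tm (ltW ab).
  - by case/andP: (t01 x).
  - by case/andP: (t01 y).
have C := @edge_chain (crd t) 1; have {}C : forall a b, olt a b -> lo (crd t) a <= hi 1 (crd t) b.
  by apply: C => a b /H; rewrite aff_facet_form subr_ge0.
split=> [i|i j]; first by rewrite (C None (Some i)) // (C (Some i) None).
rewrite le_eqVlt => /orP[/eqP->//|ij]; exact: (C (Some i) (Some j)).
Qed.

Lemma facet_form_ge0 a b t : P t -> edge [set: X] a b -> 0 <= aff (facet_form a b) t.
Proof. by move=> /order_polytopeP H; apply: H. Qed.

Lemma aff_facet_le1 a b t : P t -> edge [set: X] a b -> aff (facet_form a b) t <= 1.
Proof.
move=> [t01 _] _; rewrite aff_facet_form.
have hi1 : hi 1 (crd t) b <= 1 by case: (b) => //= y; case/andP: (t01 y).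
have lo0 : 0 <= lo (crd t) a by case: (a) => //= y; case/andP: (t01 y).
by rewrite lerBlDr (le_trans hi1) // lerDl.
Qed.

Lemma filter_point_mem J : upset [set: X] J -> P (filter_point J).
Proof.
by move=> u; apply/order_polytopeP => a b e; rewrite aff_facet_filter // ler0n.
Qed.

Lemma filter_point_inj : injective filter_point.
Proof.
move=> J K E; apply/setP=> z; have := crd_filter_point J z.
rewrite E crd_filter_point => /eqP; rewrite eqr_nat => /eqP.
by case: (z \in J); case: (z \in K).
Qed.

Lemma facet_form_neq0 a b : edge [set: X] a b -> facet_form a b != 0.
Proof.
move=> e; apply/eqP => E; have := aff_facet_filter e (upset_above b).
by rewrite E /aff mulmx0 mxE (cuts_above e) => /esym/eqP; rewrite oner_eq0.
Qed.

Definition flag_filter (s : seq X) (l : nat) := [set x in take l s].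

Definition flag_points (s : seq X) : 'M[R]_(#|X|.+1, 1 + #|X|) :=
  \matrix_(l < #|X|.+1) hpoint (filter_point (flag_filter s l)).

Lemma flag_filter_upset s l : revext s -> (forall x, x \in s) -> (l <= size s)%N ->
  upset [set: X] (flag_filter s l).
Proof.
move=> rs sX ls; have -> : [set: X] = [set x in s] by apply/setP=> x; rewrite !inE sX.
by apply: flag_upset => //; rewrite flagE; apply/mapP; exists l; rewrite ?mem_iota.
Qed.

Lemma size_revext s : revext s -> (forall x, x \in s) -> size s = #|X|.
Proof.
by case/andP=> us _ sX; rewrite -(card_uniqP us); apply: eq_card => x; rewrite sX.
Qed.

(** Paired with the forms of [flag_rows], the flag points give a triangular matrix with unit
    diagonal. *)
Lemma flag_points_free s : revext s -> (forall x, x \in s) -> row_free (flag_points s).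
Proof.
move=> rs sX; have sz := size_revext rs sX; have [e eP] := flag_rows rs sX.
pose cs (l : 'I_#|X|.+1) := cast_ord (esym (congr1 S sz)) l.
pose H : 'M[R]_(1 + #|X|, #|X|.+1) :=
  \matrix_(i, l) facet_form (e (cs l)).1 (e (cs l)).2 i 0.
have VH l l' : (flag_points s *m H) l' l =
    (cuts (flag_filter s l') (e (cs l)).1 (e (cs l)).2)%:R.
  have [el _] := eP (cs l); rewrite -aff_facet_filter //; last first.
    by apply: flag_filter_upset; rewrite // sz -ltnS.
  by rewrite /aff !mxE; apply: eq_bigr => k _; rewrite !mxE.
have cutE (l l' : 'I_#|X|.+1) : (l <= l')%N ->
    cuts (flag_filter s l') (e (cs l)).1 (e (cs l)).2 = (l == l').
  by move=> ll'; have [_ /(_ (cs l') ll') ->] := eP (cs l); rewrite -val_eqE.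
have : flag_points s *m H \in unitmx.
  rewrite unitmxE -det_tr det_trig.
    rewrite unitr_prod // => l _; rewrite mxE VH cutE // eqxx; exact: unitr1.
  apply/is_trig_mxP=> l l' ll'; rewrite mxE VH cutE ?(ltnW ll') //.
  by case: eqP => // E; rewrite E ltnn in ll'.
move=> u; apply/row_freeP; exists (H *m invmx (flag_points s *m H)).
by rewrite mulmxA mulmxV.
Qed.

Lemma revext_cat s1 s2 : revext s1 -> revext s2 -> ~~ has (mem s1) s2 ->
  (forall x y, x \in s1 -> y \in s2 -> ~~ (x < y)%O) -> revext (s1 ++ s2).
Proof.
move=> /andP[u1 p1] /andP[u2 p2] d H; rewrite /revext cat_uniq u1 u2 d pairwise_cat p1 p2 /= !andbT.
by apply/allrelP=> x y xs ys; apply: H.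
Qed.

(* A maximal flag in which b enters right before a crosses the facet (a, b)
   only once. *)
Lemma edge_flag a b : edge [set: X] a b -> exists s (l0 : 'I_#|X|.+1),
  [/\ revext s, forall x, x \in s
    & forall l : 'I_#|X|.+1, l != l0 -> ~~ cuts (flag_filter s l) a b].
Proof.
case/edgeP=> _ _ ab nb.
(* The order is: elements above a other than b, then b, a and the rest. It reverses a linear
   extension because nothing lies between a and b, and the only initial segment with b but without a
   ends just before a. *)
have [s1 r1 e1] := revext_enum [set w | olt a (Some w) && (b != Some w)].
have [s2 r2 e2] := revext_enum [set w | ~~ olt a (Some w) && (a != Some w)].
pose ob := if b is Some y then [:: y] else [::].
pose oa := if a is Some x then [:: x] else [::].
have eb z : (z \in ob) = (b == Some z) by rewrite /ob; case: (b) => //= y; rewrite inE eq_sym.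
have ea z : (z \in oa) = (a == Some z) by rewrite /oa; case: (a) => //= y; rewrite inE eq_sym.
have aa z : a = Some z -> olt a (Some z) = false by move=> ->; rewrite /= ltxx.
have rb : revext ob by rewrite /ob; case: (b).
have ra : revext oa by rewrite /oa; case: (a).
pose s := s1 ++ ob ++ oa ++ s2.
have mem z : z \in s.
  rewrite !mem_cat e1 e2 !inE ea eb.
  by case: (olt a _); case: (a == _); case: (b == _).
have abx z : b = Some z -> olt a (Some z) by move=> bz; rewrite -bz.
have rs : revext s.
  apply: revext_cat => //; first (apply: revext_cat => //; first apply: revext_cat => //).
  - apply/hasPn=> z; rewrite e2 inE => /andP[_ /negPf az] /=; by rewrite ea az.
  - move=> x y; rewrite ea e2 inE => /eqP -> /andP[/=]; by case: (x < y)%O.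
  - apply/hasPn=> z; rewrite /= eb mem_cat ea e2 inE => /orP[/eqP/aa|/andP[naz _]].
      by move=> na; apply: contraFN na => /eqP /abx.
    by apply: contra naz => /eqP /abx.
  - move=> x y; rewrite eb mem_cat ea e2 inE => /eqP/abx ax /orP[/eqP ay|/andP[nay _]].
      apply/negP => xy; move: ax; rewrite ay /= => yx.
      by have := lt_trans xy yx; rewrite ltxx.
    apply: contra nay => xy; exact: (@olt_trans _ _ (Some x) a (Some y) isT ax xy).
  - apply/hasPn=> z; rewrite !mem_cat eb ea e2 /= e1 !inE => /or3P[/eqP->|/eqP/aa ->|/andP[/negPf-> _]] //.
    by rewrite eqxx andbF.
  - move=> x y; rewrite e1 inE !mem_cat eb ea e2 inE => /andP[ax bx].
    case/or3P=> [/eqP by'|/eqP ay|/andP[nay _]]; apply/negP => xy.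
    + by apply: (nb x) => //; rewrite ?inE // by'.
    + move: ax; rewrite ay /= => yx; by have := lt_trans xy yx; rewrite ltxx.
    + by move: nay; rewrite (@olt_trans _ _ (Some x) a (Some y) isT ax xy).
have sz := size_revext rs mem.
have lt0 : (size (s1 ++ ob) < #|X|.+1)%N.
  by rewrite ltnS -sz /s !size_cat; lia.
exists s, (Ordinal lt0); split=> // l; rewrite -val_eqE /= neq_ltn => /orP[ll|ll].
  apply/negP => /andP[_]; case: b ab nb @ob eb rb @s rs mem sz lt0 ll e1 abx => [y|] ab nb ob eb rb s rs mem sz lt0 ll e1 abx /=.
    rewrite inE => yl; have : y \in s1.
      move: yl; rewrite /s takel_cat; first exact: mem_take.
      by move: ll; rewrite size_cat /= addn1 ltnS.
    by rewrite e1 inE eqxx andbF.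
  move: ll; rewrite /ob cats0; case: s1 {r1 s rs mem sz lt0} e1 => // z s1 /(_ z).
  rewrite !inE eqxx /= andbT => /esym az _; apply: (nb z) => //; exact: in_setT.
rewrite /cuts negb_and negbK; apply/orP; left.
case: a ab nb aa @oa ea ra @s rs mem sz lt0 ll e2 abx {e1} => [x|] ab nb aa oa ea ra s rs mem sz lt0 ll e2 abx /=.
  rewrite inE /s catA take_cat ltnNge (ltnW ll) /= mem_cat; apply/orP; right.
  by rewrite /oa; case: (l - _)%N (subn_gt0 (size (s1 ++ ob)) l) => [|k]; rewrite ?ll //= inE eqxx.
have s20 : s2 = [::] by case: (s2) e2 => // z s2' /(_ z); rewrite !inE eqxx.
have : (l <= size s)%N by rewrite sz -ltnS.
by rewrite /s s20 /oa !cats0 leqNgt ll.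
Qed.

Local Notation facet a b := (fun t : 'rV[R]_#|X| => P t /\ aff (facet_form a b) t = 0).

Lemma facet_points a b : edge [set: X] a b -> exists A : 'M[R]_#|X|,
  (forall i, P (row i A) /\ aff (facet_form a b) (row i A) = 0) /\
  row_free (\matrix_i hpoint (row i A)).
Proof.
move=> e; have [s [l0 [rs sX cu]]] := edge_flag e.
exists (\matrix_(i < #|X|) filter_point (flag_filter s (lift l0 i))).
have u (l : 'I_#|X|.+1) : upset [set: X] (flag_filter s l).
  by apply: flag_filter_upset; rewrite // (size_revext rs sX) -ltnS.
split=> [i|].
  rewrite rowK; split; first exact: filter_point_mem.
  have nl : lift l0 i != l0 by rewrite eq_sym neq_lift.
  by rewrite aff_facet_filter // (negPf (cu _ nl)).
have -> : \matrix_i hpoint (row i (\matrix_(i < #|X|) filter_point (flag_filter s (lift l0 i)))) =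
    rowsub (lift l0) (flag_points s).
  by apply/row_matrixP=> i; rewrite rowK rowK; apply/rowP=> j; rewrite !mxE.
by apply: row_free_rowsub (flag_points_free rs sX); apply: lift_inj.
Qed.

Definition hasse_form (i : 'I_#|hasse X|) := facet_form (enum_val i).1 (enum_val i).2.
Definition filter_vertex (j : 'I_#|filters X|) := filter_point (enum_val j).

Lemma hasse_edge (i : 'I_#|hasse X|) : edge [set: X] (enum_val i).1 (enum_val i).2.
Proof. by have := enum_valP i; rewrite inE. Qed.

Lemma filters_upset (j : 'I_#|filters X|) : upset [set: X] (enum_val j).
Proof. by have := enum_valP j; rewrite inE. Qed.

Lemma is_facet_form a b : edge [set: X] a b ->
  is_facet P (classical_sets.mkset (facet a b)).
Proof.
move=> e; split.
  by exists (facet_form a b); split=> // x Px; exact: facet_form_ge0.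
split; first by have [A [FA rA]] := facet_points e; exists A.
move=> m A FA rA; apply: affine_rank_hyperplane (facet_form_neq0 e) _ FA rA.
by move=> x [].
Qed.

Lemma filters_vanish (c : 'cV[R]_(1 + #|X|)) :
  (forall J, upset [set: X] J -> aff c (filter_point J) = 0) -> c = 0.
Proof.
move=> H; have [s rs sT] := revext_enum [set: X].
have sX x : x \in s by rewrite sT inE.
have /row_freeP[B VB] := flag_points_free rs sX.
have Vu : flag_points s \in unitmx by have [] := mulmx1_unit VB.
rewrite -[c](mulKmx Vu) (_ : _ *m c = 0) ?mulmx0 //.
apply/matrixP=> l j; rewrite !ord1 [RHS]mxE -[RHS](H (flag_filter s l)); last first.
  by apply: flag_filter_upset; rewrite // (size_revext rs sX) -ltnS.
by rewrite /aff !mxE; apply: eq_bigr => k _; rewrite mxE.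
Qed.

(* A face in no facet contains a point g where all facet forms are positive;
   moving from g slightly away from any vertex stays inside the polytope. *)
Lemma facetP (G : classical_sets.set 'rV[R]_#|X|) : is_facet P G ->
  exists a b, edge [set: X] a b /\ G = classical_sets.mkset (facet a b).
Proof.
move=> [[c [c0 ->]] [[A [GA rA]] Gmax]].
have cn0 : c <> 0.
  move=> cE; have [s rs sT] := revext_enum [set: X].
  have sX x : x \in s by rewrite sT inE.
  have := Gmax #|X|.+1 (\matrix_(l < #|X|.+1) filter_point (flag_filter s l)); rewrite ltnn => H.
  suff: false by []. apply: H => [i|].
    rewrite rowK; split; last by rewrite cE /aff mulmx0 mxE.
    by apply/filter_point_mem/flag_filter_upset; rewrite // (size_revext rs sX) -ltnS.
  rewrite (_ : \matrix_i _ = flag_points s) ?flag_points_free //.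
  by apply/row_matrixP=> i; rewrite !rowK.
case: (boolp.EM (exists a b, edge [set: X] a b /\
    forall t, P t -> aff c t = 0 -> aff (facet_form a b) t = 0)) => [[a [b [e H]]]|no].
  exists a, b; split=> //; have [k ck] : exists k, c = k *: facet_form a b.
    have B0 (c' : 'cV[R]_(1 + #|X|)) : (forall i, aff c' (row i A) = 0) ->
        (\matrix_i hpoint (row i A)) *m c' = 0.
      move=> H'; apply/matrixP=> i j; rewrite !ord1 mxE [RHS]mxE -[RHS](H' i) /aff mxE.
      by apply: eq_bigr => k _; rewrite mxE.
    apply: hyperplane_unique rA erefl (B0 _ _) (B0 _ _) (facet_form_neq0 e) => i.
      by case: (GA i).
    by case: (GA i) => h1 h2; apply: H.
  have kn0 : k != 0 by apply/eqP => k0; apply: cn0; rewrite ck k0 scale0r.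
  have affk t : aff c t = k * aff (facet_form a b) t.
    by rewrite /aff ck -scalemxAr mxE.
  apply/boolp.predeqP => t; split=> -[Pt E]; split=> //; first exact: H.
  by rewrite affk E mulr0.
exfalso; apply: cn0.
have gE (i : 'I_#|hasse X|) : exists t, [/\ P t, aff c t = 0 &
    0 < aff (facet_form (enum_val i).1 (enum_val i).2) t].
  have e := hasse_edge i; apply: boolp.contrapT => nt; apply: no; exists (enum_val i).1, (enum_val i).2; split=> // t Pt ct.
  apply/eqP/negPn/negP => tn; apply: nt; exists t; split=> //.
  by rewrite lt_neqAle eq_sym tn facet_form_ge0.
have [g gP] := fin_all_exists gE.
have m0 : (0 < #|hasse X|)%N.
  by have [a e] := edge_top [set: X]; apply/card_gt0P; exists (a, None); rewrite inE.
pose w := fun i : 'I_#|hasse X| => (#|hasse X|%:R : R)^-1.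
have w1 : \sum_i w i = 1.
  by rewrite /w sumr_const card_ord -[LHS]mulr_natl mulfV // pnatr_eq0 -lt0n.
have wpos i : 0 < w i by rewrite invr_gt0 ltr0n.
pose g0 := \sum_i w i *: g i.
have hge (i j : 'I_#|hasse X|) : 0 <= aff (facet_form (enum_val i).1 (enum_val i).2) (g j).
  by case: (gP j) => Pg _ _; apply: facet_form_ge0 (hasse_edge i).
have hpos (i : 'I_#|hasse X|) : 0 < aff (facet_form (enum_val i).1 (enum_val i).2) g0.
  rewrite aff_comb // (bigD1 i) //= ltr_wpDr //; first by apply: sumr_ge0 => j _; rewrite mulr_ge0 // ltW.
  by rewrite mulr_gt0 //; case: (gP i).
have cg0 : aff c g0 = 0.
  by rewrite aff_comb // big1 // => i _; case: (gP i) => _ -> _; rewrite mulr0.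
have posE a b : edge [set: X] a b -> 0 < aff (facet_form a b) g0.
  move=> e; have ab : (a, b) \in hasse X by rewrite inE.
  by have := hpos (enum_rank_in ab (a, b)); rewrite enum_rankK_in.
have Pg0 : P g0 by apply/order_polytopeP => a b /posE/ltW.
(* The factors lie in (0, 1], so the product is a positive lower bound for each of them. *)
pose ep := \prod_i aff (hasse_form i) g0.
have ep0 : 0 < ep by apply: prodr_gt0 => i _; apply: hpos.
have epE a b : edge [set: X] a b -> ep <= aff (facet_form a b) g0.
  move=> e; have ab : (a, b) \in hasse X by rewrite inE.
  rewrite /ep (bigD1 (enum_rank_in ab (a, b))) //= {1}/hasse_form enum_rankK_in //=.
  rewrite ler_piMr ?(ltW (posE _ _ e)) // prodr_ile1 // => i _.
  by rewrite (ltW (hpos i)) aff_facet_le1 // hasse_edge.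
apply: filters_vanish => J uJ.
have Pv := filter_point_mem uJ.
apply/eqP; rewrite eq_le c0 // andbT.
have : 0 <= aff c ((1 - (- ep)) *: g0 + (- ep) *: filter_point J).
  apply: c0; apply/order_polytopeP => a b e; rewrite aff_comb2 opprK mulNr subr_ge0.
  apply: le_trans (_ : ep * 1 <= _); first by rewrite ler_pM2l // aff_facet_le1.
  rewrite mulr1 mulrDl mul1r; apply: ler_wpDr; last exact: epE.
  by rewrite mulr_ge0 ?(ltW ep0) ?(ltW (posE _ _ e)).
by rewrite aff_comb2 cg0 mulr0 add0r mulNr oppr_ge0 pmulr_rle0.
Qed.

(** On the cube c is the l1 distance to the filter point. *)
Lemma is_vertex_filter J : upset [set: X] J -> is_vertex P (filter_point J).
Proof.
move=> uJ; pose c : 'cV[R]_(1 + #|X|) :=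
  col_mx (#|J|%:R)%:M (\col_k (-1) ^+ (enum_val k \in J)).
have cE t : aff c t = \sum_i (if i \in J then 1 - crd t i else crd t i).
  rewrite affE /c col_mxEu mxE eqxx mulr1n.
  have -> : (#|J|%:R : R) = \sum_i (i \in J)%:R.
    by rewrite -sum1_card natr_sum big_mkcond; apply: eq_bigr => i _; case: (i \in J).
  rewrite [X in _ + X](reindex enum_rank) /=; last exact/onW_bij/enum_rank_bij.
  rewrite -big_split; apply: eq_bigr => i _ /=; rewrite col_mxEd mxE enum_rankK.
  by case: (i \in J); rewrite ?expr1 ?expr0 ?mulrN1 ?mulr1 ?add0r.
have ge0 t i : P t -> 0 <= (if i \in J then 1 - crd t i else crd t i).
  by move=> [/(_ i)/andP[t0 t1] _]; case: ifP; rewrite ?subr_ge0.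
exists c; split=> [t Pt|]; first by rewrite cE; apply: sumr_ge0 => i _; apply: ge0.
apply/boolp.predeqP => t; split=> [->|[Pt E]].
  split; first exact: filter_point_mem.
  by rewrite cE big1 // => i _; rewrite crd_filter_point; case: (i \in J); rewrite ?subrr.
apply: crd_inj => i; rewrite crd_filter_point.
move/eqP: E; rewrite cE psumr_eq0 => [/allP/(_ i)|j _]; last exact: ge0.
rewrite mem_index_enum => /(_ isT); case: (i \in J) => /=; last by move/eqP.
by rewrite subr_eq0 => /eqP <-.
Qed.

(* t is the midpoint of its images under s |-> 2s - s^2 and s |-> s^2, which
   preserve the order and [0, 1]; so a vertex is fixed by s |-> s^2. *)
Lemma vertex_filter t : is_vertex P t -> exists2 J, upset [set: X] J & t = filter_point J.
Proof.
move=> [c [c0 E]].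
have [Pt ct] : P t /\ aff c t = 0 by have := congr1 (fun F => F t) E => /= <-.
have uniq_t t' : P t' -> aff c t' = 0 -> t' = t.
  by move=> Pt' ct'; have := congr1 (fun F => F t') E => /= ->.
case: (Pt) => t01 tm.
pose q : 'rV[R]_#|X| := \row_k (t 0 k) ^+ 2.
pose p : 'rV[R]_#|X| := \row_k ((t 0 k) *+ 2 - (t 0 k) ^+ 2).
have Pq : P q.
  split=> [i|i j /tm ij]; rewrite !mxE; case/andP: (t01 i) => i0 i1.
    by rewrite sqr_ge0 expr_le1.
  by rewrite lerXn2r // nnegrE // (le_trans i0).
have Pp : P p.
  split=> [i|i j ij]; rewrite !mxE; case/andP: (t01 i) => i0 i1.
    by apply/andP; split; nra.
  have := tm _ _ ij; case/andP: (t01 j); nra.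
have half : aff c p + aff c q = 0.
  have tE : t = (1 - 2^-1) *: p + 2^-1 *: q by apply/rowP=> k; rewrite !mxE; field.
  move: ct; rewrite tE aff_comb2 (_ : 1 - 2^-1 = 2^-1 :> R); last by field.
  by rewrite -mulrDr => /eqP; rewrite mulf_eq0 invr_eq0 pnatr_eq0 => /eqP.
have cq : aff c q = 0.
  have := c0 _ Pp; have := c0 _ Pq; lra.
have qt := uniq_t _ Pq cq.
have t2 i : (crd t i == 0) || (crd t i == 1).
  have := congr1 (fun r : 'rV_#|X| => r 0 (enum_rank i)) qt; rewrite mxE -/(crd t i) => /eqP.
  by rewrite expr2 -subr_eq0 -[X in _ - X]mulr1 -mulrBr mulf_eq0 subr_eq0.
exists [set i | crd t i == 1].
  apply/upsetP; split=> [|i j]; first exact: subsetT.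
  rewrite !inE => /eqP i1 _ /tm; rewrite -!/(crd _ _) i1 => j1.
  by rewrite eq_le j1; case/andP: (t01 j) => _ ->.
apply: crd_inj => i; rewrite crd_filter_point inE; case/orP: (t2 i) => /eqP ->; rewrite ?eqxx //.
by rewrite eq_sym oner_eq0.
Qed.

Lemma order_polytope_facets_vertices : facets_vertices P hasse_form filter_vertex.
Proof.
have hP t : P t <-> forall i, 0 <= aff (hasse_form i) t.
  rewrite order_polytopeP; split=> [H i|H a b e]; first exact/H/hasse_edge.
  have ab : (a, b) \in hasse X by rewrite inE.
  by have := H (enum_rank_in ab (a, b)); rewrite /hasse_form enum_rankK_in.
split; first by apply/boolp.predeqP => t; exact: hP.
  split=> [i i' E|G]; last first.
    split=> [/facetP[a [b [e ->]]]|[i ->]]; last exact/is_facet_form/hasse_edge.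
    have ab : (a, b) \in hasse X by rewrite inE.
    by exists (enum_rank_in ab (a, b)); rewrite /hasse_form enum_rankK_in.
  have cE J : upset [set: X] J ->
      cuts J (enum_val i).1 (enum_val i).2 = cuts J (enum_val i').1 (enum_val i').2.
    move=> u; have := congr1 (fun F => F (filter_point J)) E => /= EJ.
    have : (P (filter_point J) /\ aff (hasse_form i) (filter_point J) = 0) <->
      (P (filter_point J) /\ aff (hasse_form i') (filter_point J) = 0) by rewrite EJ.
    rewrite /hasse_form !aff_facet_filter //; try exact: hasse_edge.
    have Pv := filter_point_mem u.
    by case: (cuts _ _ _); case: (cuts _ _ _) => // -[H1 H2];
      [have [_ /eqP] := H2 (conj Pv erefl)|have [_ /eqP] := H1 (conj Pv erefl)];
      rewrite oner_eq0.
  apply: enum_val_inj; move: cE (hasse_edge i) (hasse_edge i').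
  case: (enum_val i) (enum_val i') => [a b] [a' b'] /= cE e e'.
  have := cE _ (upset_above b); have := cE _ (upset_above b').
  rewrite (cuts_above e) (cuts_above e').
  have := cE _ (upset_not_below a); have := cE _ (upset_not_below a').
  rewrite (cuts_not_below e) (cuts_not_below e').
  rewrite /cuts => /andP[h1 _] /esym/andP[h2 _] /andP[_ h3] /esym/andP[_ h4].
  congr (_, _).
    move: h1 h2; rewrite /not_below; case: (a) (a') => [x|] [x'|] //=; rewrite ?inE ?negbK // => h1 h2.
    by congr Some; apply/eqP; rewrite eq_le h1 h2.
  move: h3 h4; rewrite /above; case: (b) (b') => [x|] [x'|] //=; rewrite ?inE // => k1 k2.
  by congr Some; apply/eqP; rewrite eq_le k1 k2.
split=> [j j' /filter_point_inj/enum_val_inj //|t]; split=> [/vertex_filter[J u ->]|[j ->]].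
  have JF : J \in filters X by rewrite inE.
  by exists (enum_rank_in JF J); rewrite /filter_vertex enum_rankK_in.
exact/is_vertex_filter/filters_upset.
Qed.

Lemma slack_matrixE i j : slack_matrix hasse_form filter_vertex i j =
  (cuts (enum_val j) (enum_val i).1 (enum_val i).2)%:R.
Proof. by rewrite mxE aff_facet_filter //; [exact: hasse_edge|exact: filters_upset]. Qed.

(** The matrix factors through the homogeneous space of dimension d + 1. *)
Lemma slack_minors m n d (h : 'I_m -> 'cV[R]_(1 + d)) (v : 'I_n -> 'rV[R]_d) :
  forall (f : 'I_d.+2 -> 'I_m) (g : 'I_d.+2 -> 'I_n),
  \det (mxsub f g (slack_matrix h v)) = 0.
Proof.
move=> f g; have -> : mxsub f g (slack_matrix h v) =
    (\matrix_(a, k) h (f a) k 0) *m (\matrix_(k, b) hpoint (v (g b)) 0 k).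
  apply/matrixP=> a b; rewrite [LHS]mxE [LHS]mxE /aff mxE [RHS]mxE.
  by apply: eq_bigr => k _; rewrite [X in _ = X * _]mxE [X in _ = _ * X]mxE mulrC.
apply/eqP; rewrite -[_ == 0]negbK -unitfE -unitmxE -row_full_unit /row_full neq_ltn.
by rewrite ltnS mulmx_max_rank.
Qed.

End OrderPolytope.

(** * Projective uniqueness *)

Section Decomposition.
Context {R : realType} {disp : Order.disp_t} {X : finPOrderType disp}.

(** The support of u is a filter; subtracting its indicator times the smallest positive value of u
    shrinks the support. What remains of c in the end is the weight of the empty filter. *)
Lemma monotone_decomposition (u : X -> R) (c : R) :
  (forall i, 0 <= u i <= c) -> 0 <= c -> {homo u : i j / (i <= j)%O >-> i <= j} ->
  exists w : {set X} -> R, [/\ forall J, 0 <= w J,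
    forall J, J \notin filters X -> w J = 0, \sum_J w J = c
    & forall i, u i = \sum_J w J * (i \in J)%:R].
Proof.
have [n] := ubnP #|[set i | 0 < u i]|; elim: n u c => // n IH u c; rewrite ltnS => le_n uc c0 um.
case: (set_0Vmem [set i | 0 < u i]) => [E|[x0 x0J]].
  have u0 i : u i = 0.
    apply/eqP; rewrite eq_le; case/andP: (uc i) => -> _; rewrite andbT leNgt.
    by have /setP/(_ i) := E; rewrite !inE => ->.
  exists (fun J => if J == set0 then c else 0); split=> [J|J|//|i].
  - by case: ifP.
  - by case: eqP => // ->; rewrite inE => /negP[]; apply/upsetP; split=> [|x y]; rewrite ?sub0set ?inE.
  - by rewrite -big_mkcond big_pred1_eq.
  - rewrite u0 big1 // => J _; case: eqP => [->|]; by rewrite ?inE ?mulr0 ?mul0r.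
set J0 := [set i | 0 < u i] in le_n x0J.
case: (@Order.TotalTheory.arg_minP _ _ _ x0 (fun i => i \in J0) u x0J) => m mJ mmin.
have um0 : 0 < u m by move: mJ; rewrite inE.
pose v i := u i - u m * (i \in J0)%:R.
have uJ i : i \notin J0 -> u i = 0.
  by rewrite inE -leNgt => ui; apply/eqP; rewrite eq_le ui; case/andP: (uc i).
have uJ0 : J0 \in filters X.
  rewrite inE; apply/upsetP; split=> [|i j]; first exact: subsetT.
  by rewrite !inE => ui _ /um; apply: lt_le_trans.
have [||||w [w0 wF wc wE]] := IH v (c - u m).
- apply: leq_trans le_n; apply: proper_card; apply/properP; split.
    apply/subsetP=> i; rewrite !inE /v; case: (boolP (i \in J0)) => [|/uJ ->]; first by rewrite inE.
    by rewrite mulr0 subr0.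
  by exists m; rewrite // inE /v mJ mulr1 subrr ltxx.
- move=> i; rewrite /v; case: (boolP (i \in J0)) => iJ; case/andP: (uc i) => u0 u1.
    by rewrite mulr1 subr_ge0 mmin //= lerD2r.
  by rewrite uJ // mulr0 subrr lexx subr_ge0; case/andP: (uc m).
- by rewrite subr_ge0; case/andP: (uc m).
- move=> i j ij; rewrite /v; have := um _ _ ij.
  case: (boolP (i \in J0)) => iJ; case: (boolP (j \in J0)) => jJ; rewrite ?mulr1 ?mulr0 ?subr0 ?lerD2r //.
    by rewrite (uJ _ jJ); move: iJ; rewrite inE => h1 h2; have := lt_le_trans h1 h2; rewrite ltxx.
  by rewrite (uJ _ iJ) subr_ge0 => _; apply: mmin.
exists (fun J => w J + (if J == J0 then u m else 0)); split.
- by move=> J; rewrite addr_ge0 //; case: ifP => // _; apply: ltW.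
- by move=> J JF; rewrite wF // add0r; case: eqP => // E; rewrite E uJ0 in JF.
- by rewrite big_split -big_mkcond big_pred1_eq wc /= subrK.
move=> i; under eq_bigr do rewrite mulrDl.
rewrite big_split -wE /= (bigD1 J0) //= eqxx big1 ?addr0; last first.
  by move=> J /negPf ->; rewrite mul0r.
by rewrite /v subrK.
Qed.

Lemma order_polytope_hull (t : 'rV[R]_#|X|) : order_polytope R X t ->
  exists w : 'I_#|filters X| -> R, [/\ forall j, 0 <= w j, \sum_j w j = 1
    & t = \sum_j w j *: filter_vertex j].
Proof.
move=> [t01 tm]; have [w [w0 wF w1 wE]] := monotone_decomposition t01 ler01 tm.
have S (f : {set X} -> R) : \sum_J w J * f J = \sum_(j < #|filters X|) w (enum_val j) * f (enum_val j).
  rewrite -(big_enum_val (fun J => w J * f J)) [RHS]big_mkcond; apply: eq_bigr => J _.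
  by case: ifP => // /negbT/wF ->; rewrite mul0r.
exists (fun j => w (enum_val j)); split=> //.
  rewrite -w1 [RHS](eq_bigr (fun J => w J * 1)) ?S; last by move=> J _; rewrite mulr1.
  by apply: eq_bigr => j _; rewrite mulr1.
apply/rowP=> k; rewrite -(enum_valK k) wE S summxE; apply: eq_bigr => j _.
by rewrite !mxE enum_rankK.
Qed.

End Decomposition.

Section ProjectiveUniqueness.
Context {R : realType} {disp : Order.disp_t} {X : finPOrderType disp}.
Hypothesis width2 : forall x y z : X, (x >< y)%O -> (y >< z)%O -> (x >< z)%O -> False.
Hypothesis Xranked : ranked X.
Local Notation P := (order_polytope R X).
Local Notation d := #|X|.

Lemma facet_cone (z : 'rV[R]_(1 + d)) :
  (forall a b, edge [set: X] a b -> 0 <= (z *m facet_form a b) 0 0) ->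
  forall k, 0 <= z 0 (rshift 1 k) <= z 0 (lshift d 0).
Proof.
move=> H k; pose u i := z 0 (rshift 1 (enum_rank i)); set U := z 0 (lshift d 0).
have C := @edge_chain _ _ _ u U; have {}C : forall a b, olt a b -> lo u a <= hi U u b.
  by apply: C => a b /H; rewrite mul_facet_form subr_ge0.
have := C None (Some (enum_val k)) isT; have := C (Some (enum_val k)) None isT.
by rewrite /= /u enum_valK => -> ->.
Qed.

Lemma facet_cone0 (z : 'rV[R]_(1 + d)) :
  (forall a b, edge [set: X] a b -> 0 <= (z *m facet_form a b) 0 0) -> 0 <= z 0 (lshift d 0).
Proof.
move=> H; pose u i := z 0 (rshift 1 (enum_rank i)); set U := z 0 (lshift d 0).
apply: (@edge_chain _ _ _ u U _ None None isT) => a b /H.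
by rewrite mul_facet_form subr_ge0.
Qed.

(** Both z and its opposite lie in the cone over the polytope, which is pointed. *)
Lemma facet_forms_free (z : 'rV[R]_(1 + d)) :
  (forall a b, edge [set: X] a b -> (z *m facet_form a b) 0 0 = 0) -> z = 0.
Proof.
move=> H; have h1 : forall a b, edge [set: X] a b -> 0 <= (z *m facet_form a b) 0 0.
  by move=> a b /H ->.
have h2 : forall a b, edge [set: X] a b -> 0 <= (- z *m facet_form a b) 0 0.
  by move=> a b /H E; rewrite mulNmx mxE E oppr0.
have z0 : z 0 (lshift d 0) = 0.
  apply/eqP; rewrite eq_le (facet_cone0 h1) andbT -oppr_ge0.
  by have := facet_cone0 h2; rewrite mxE.
apply/rowP=> k; rewrite [RHS]mxE; case: (splitP k) => k' kk'.
  have -> : k = lshift d k' by apply: val_inj.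
  by rewrite ord1.
have -> : k = rshift 1 k' by apply: val_inj.
by have := facet_cone h1 k'; rewrite z0 => /andP[h3 h4]; apply/eqP; rewrite eq_le h3 h4.
Qed.

(** If J cut no edge, minus its indicator, with values 0 at the bottom and -1 at the top, would be
    nondecreasing from bottom to top. *)
Lemma filter_cuts_edge J : exists a b, edge [set: X] a b /\ cuts J a b.
Proof.
apply: boolp.contrapT => no; pose u i : R := - (i \in J)%:R.
have : lo u None <= hi (-1) u None.
  apply: edge_chain => // a b e; have : ~~ cuts J a b by apply/negP => c; apply: no; exists a, b.
  rewrite /cuts negb_and negbK => h.
  have -> : lo u a = - (inlo J a)%:R by case: (a) => //=; rewrite oppr0.
  have -> : hi (-1) u b = - (oin J b)%:R by case: (b).
  by rewrite lerN2 ler_nat; case/orP: h => [->|/negPf ->]; [case: (oin J b)|].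
by rewrite /= leNgt ltrN10.
Qed.

Lemma is_face0 (Q : classical_sets.set 'rV[R]_d) : is_face Q classical_sets.set0.
Proof.
exists (delta_mx (lshift d 0) 0); have E x : aff (delta_mx (lshift d 0) 0) x = 1 :> R.
  by rewrite affE mxE !eqxx big1 ?addr0 // => k _; rewrite mxE eq_rlshift mulr0.
split=> [x _|]; first by rewrite E.
by apply/boolp.predeqP => x; split=> // -[_ /eqP]; rewrite E oner_eq0.
Qed.

(** Here c i exposes the image of facet i, and q j is any point in the image of vertex j, which is
    nonempty because only the empty face can map to the empty face. *)
Lemma comb_equiv_slack (Q : classical_sets.set 'rV[R]_d) : comb_equiv P Q ->
  exists (c : 'I_#|hasse X| -> 'cV[R]_(1 + d)) (q : 'I_#|filters X| -> 'rV[R]_d),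
    [/\ forall i x, Q x -> 0 <= aff (c i) x, forall j, Q (q j)
      & forall i j, (aff (c i) (q j) != 0) = cuts (enum_val j) (enum_val i).1 (enum_val i).2].
Proof.
move=> [phi [phiF phiS phiI]].
pose F i := classical_sets.mkset (fun t => P t /\ aff (hasse_form i) t = 0).
have Fface i : is_face P (F i).
  by exists (hasse_form i); split=> // x Px; apply: facet_form_ge0 (hasse_edge i).
have Vface j : is_face P (classical_sets.set1 (filter_vertex j)).
  exact: is_vertex_filter (filters_upset j).
have E0 := is_face0 P.
have phi0 t : ~ phi classical_sets.set0 t.
  have := is_face0 Q.
  case/phiS=> G Gf G0 t0; have [H _] := phiI _ _ E0 Gf.
  by have := H (fun u (h : False) => match h with end) t t0; rewrite G0.
have cE i : exists c : 'cV[R]_(1 + d), (forall x, Q x -> 0 <= aff c x) /\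
    phi (F i) = classical_sets.mkset (fun x => Q x /\ aff c x = 0).
  by have [c Hc] := phiF _ (Fface i); exists c.
have [c cP] := fin_all_exists cE.
have qE j : exists q, phi (classical_sets.set1 (filter_vertex j)) q.
  apply: boolp.contrapT => no; have [_ H] := phiI _ _ (Vface j) E0.
  by apply: (H (fun q hq => False_ind _ (no (ex_intro _ q hq))) (filter_vertex j)).
have [q qP] := fin_all_exists qE.
have QF G x : is_face P G -> phi G x -> Q x.
  by move=> /phiF[e [_ ->]] [].
exists c, q; split=> [i x|j|i j]; first by case: (cP i) => H _; apply: H.
  exact: QF (Vface j) (qP j).
have Qq := QF _ _ (Vface j) (qP j); have [ci0 phiFi] := cP i.
have vE := slack_matrixE (R := R) i j; rewrite mxE in vE.
apply/idP/idP => [|cu].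
  apply: contraNT => /negPf ncu; rewrite ncu in vE.
  have [H _] := phiI _ _ (Vface j) (Fface i).
  have : phi (F i) (q j).
    apply: H (qP j) => x ->; split=> //; exact/filter_point_mem/filters_upset.
  by rewrite phiFi => -[_ ->].
apply/eqP => cq0; have [c' [c'0 phiV]] := phiF _ (Vface j).
(* The sum of the two supporting functionals exposes the intersection of the two image faces. The
   face of P mapping to it lies in vertex j and in facet i, so it is empty, although q j is in the
   intersection. *)
have Kf : is_face Q (classical_sets.mkset (fun x => phi (classical_sets.set1 (filter_vertex j)) x /\ phi (F i) x)).
  have affD x : aff (c i + c') x = aff (c i) x + aff c' x by rewrite /aff mulmxDr mxE.
  exists (c i + c'); split=> [x Qx|]; first by rewrite affD addr_ge0 ?ci0 ?c'0.
  apply/boolp.predeqP => x; rewrite phiFi phiV /=; split=> [[[Qx h1] [_ h2]]|[Qx]].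
    by split=> //; rewrite affD h1 h2 addr0.
  rewrite affD => /eqP; rewrite paddr_eq0 ?ci0 ?c'0 // => /andP[/eqP h1 /eqP h2].
  by [].
have [G Gf GE] := phiS _ Kf.
have Gq : phi G (q j) by rewrite GE; split; [exact: qP|rewrite phiFi].
have GV : classical_sets.subset G (classical_sets.set1 (filter_vertex j)).
  by apply/(phiI _ _ Gf (Vface j)); rewrite GE => x [].
have GF : classical_sets.subset G (F i).
  by apply/(phiI _ _ Gf (Fface i)); rewrite GE => x [].
have G0 : classical_sets.subset G classical_sets.set0.
  move=> x Gx; have := GV _ Gx => /= xv; have [_] := GF _ Gx; rewrite xv vE cu => /eqP.
  by rewrite oner_eq0.
exact: phi0 ((phiI _ _ Gf E0).1 G0 _ Gq).
Qed.

Lemma polytope_comb (Q : classical_sets.set 'rV[R]_d) n (w : 'I_n -> R) (q : 'I_n -> 'rV[R]_d) :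
  is_polytope Q -> (forall j, 0 <= w j) -> \sum_j w j = 1 -> (forall j, Q (q j)) ->
  Q (\sum_j w j *: q j).
Proof.
move=> [k [V QE]] w0 w1 Qq.
have uE j : exists u : 'rV[R]_k, [/\ forall i, 0 <= u 0 i, \sum_i u 0 i = 1 & q j = u *m V].
  by have := Qq j; rewrite QE.
have [u uP] := fin_all_exists uE.
rewrite QE; exists (\sum_j w j *: u j); split=> [i||].
- rewrite summxE sumr_ge0 // => j _; rewrite mxE mulr_ge0 //.
  by case: (uP j).
- under eq_bigr do rewrite summxE.
  rewrite exchange_big -[RHS]w1; apply: eq_bigr => j _.
  under eq_bigr do rewrite mxE.
  by rewrite -mulr_sumr; case: (uP j) => _ -> _; rewrite mulr1.
- rewrite mulmx_suml; apply: eq_bigr => j _.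
  by case: (uP j) => _ _ ->; rewrite scalemxAl.
Qed.

(** Real factors may be negative, but since both slack matrices are nonnegative their absolute
    values work as well. *)
Lemma positive_scaling (c : 'I_#|hasse X| -> 'cV[R]_(1 + d)) (q : 'I_#|filters X| -> 'rV[R]_d) :
  (forall i j, 0 <= aff (c i) (q j)) ->
  (forall i j, (aff (c i) (q j) != 0) = cuts (enum_val j) (enum_val i).1 (enum_val i).2) ->
  exists (r : 'I_#|hasse X| -> R) (t : 'I_#|filters X| -> R),
    [/\ forall i, 0 < r i, forall j, 0 < t j
      & forall i j, aff (c i) (q j) = r i * t j * aff (hasse_form i) (filter_vertex j)].
Proof.
move=> cq0 cqE; have [||r [t H]] := slack_scaling width2 Xranked (N := slack_matrix c q).
- move=> i j /=; rewrite mxE -cqE; case: eqP => [->|/eqP]; rewrite ?eqxx //.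
  by rewrite unitfE.
- by move=> p [f [g [_ _ ->]]]; apply: slack_minors.
have {}H i j : aff (c i) (q j) = r i * t j * aff (hasse_form i) (filter_vertex j).
  have vE := slack_matrixE (R := R) i j; rewrite mxE in vE; rewrite vE.
  case cu: (cuts _ _ _); first by rewrite mulr1 -H // mxE.
  by apply/eqP; rewrite mulr0 -[_ == 0]negbK cqE cu.
have rt i j : cuts (enum_val j) (enum_val i).1 (enum_val i).2 -> r i * t j != 0.
  by rewrite -cqE H mulf_eq0 => /norP[].
exists (fun i => `|r i|), (fun j => `|t j|); split=> [i|j|i j].
- rewrite normr_gt0; pose J := above (enum_val i).2.
  have JF : J \in filters X by rewrite inE upset_above.
  have := rt i (enum_rank_in JF J); rewrite enum_rankK_in // (cuts_above (hasse_edge i)) => /(_ isT).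
  by rewrite mulf_eq0 => /norP[].
- rewrite normr_gt0; have [a [b [e cu]]] := filter_cuts_edge (enum_val j).
  have abE : (a, b) \in hasse X by rewrite inE.
  have := rt (enum_rank_in abE (a, b)) j; rewrite enum_rankK_in // => /(_ cu).
  by rewrite mulf_eq0 => /norP[].
rewrite -[LHS]ger0_norm ?cq0 // H !normrM [X in _ * X = _]ger0_norm //.
exact/facet_form_ge0/hasse_edge/filter_point_mem/filters_upset.
Qed.

Theorem order_polytope_projectively_unique : projectively_unique P.
Proof.
move=> Q Qpoly _ /comb_equiv_slack[c [q [cQ Qq cqE]]].
have cq0 i j : 0 <= aff (c i) (q j) by apply: cQ.
have [r [t [r0 t0 rtE]]] := positive_scaling cq0 cqE.
have [s rs sT] := revext_enum [set: X].
have sX x : x \in s by rewrite sT inE.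
have sz := size_revext rs sX.
have fl_upset (l : 'I_d.+1) : flag_filter s l \in filters X.
  by rewrite inE; apply: flag_filter_upset; rewrite // sz -ltnS.
pose fl (l : 'I_d.+1) := enum_rank_in (fl_upset l) (flag_filter s l).
have flE l : filter_vertex (fl l) = filter_point (flag_filter s l) :> 'rV[R]_d.
  by rewrite /filter_vertex enum_rankK_in.
pose V : 'M[R]_d.+1 := flag_points s.
have Vu : V \in unitmx by rewrite -row_free_unit; apply: flag_points_free.
(* The homogenized flag vertices form a basis; N sends them to the multiples of the q prescribed by
   t. *)
pose N : 'M[R]_d.+1 := invmx V *m \matrix_l ((t (fl l))^-1 *: hpoint (q (fl l))).
have VN (l : 'I_d.+1) : hpoint (filter_vertex (fl l)) *m N = (t (fl l))^-1 *: hpoint (q (fl l)).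
  transitivity (row l (V *m N)); first by rewrite row_mul rowK flE.
  by rewrite mulKVmx // rowK.
have tn0 j : t j != 0 by rewrite gt_eqF.
have NC i : N *m c i = r i *: hasse_form i.
  apply: (can_inj (mulKmx Vu)); apply/matrixP=> l k; rewrite !ord1.
  have E (y : 'cV[R]_(1 + d)) : (V *m y) l 0 = (hpoint (filter_vertex (fl l)) *m y) 0 0.
    by rewrite flE !mxE; apply: eq_bigr => k' _; rewrite mxE.
  rewrite !E mulmxA VN -scalemxAl -scalemxAr [LHS]mxE [RHS]mxE -!/(aff _ _) rtE.
  by rewrite [r i * _]mulrC -mulrA mulKf.
have inj (z : 'rV[R]_(1 + d)) : (forall i, (z *m N *m c i) 0 0 = 0) -> z = 0.
  move=> H; apply: facet_forms_free => a b e.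
  have abE : (a, b) \in hasse X by rewrite inE.
  have := H (enum_rank_in abE (a, b)); rewrite -mulmxA NC -scalemxAr mxE => /eqP.
  rewrite mulf_eq0 gt_eqF //= => /eqP; by rewrite /hasse_form enum_rankK_in.
have Nu : N \in unitmx.
  rewrite -row_free_unit; apply: inj_row_free => z zN; apply: inj => i.
  by rewrite zN mul0mx mxE.
(* Off the flag too, both sides have the same values under all c i by the scaling relation, and the
   c i separate vectors. *)
have vN j : hpoint (filter_vertex j) *m N = (t j)^-1 *: hpoint (q j).
  apply/eqP; rewrite -subr_eq0; apply/eqP; set z := _ - _.
  rewrite -[z](mulmxKV Nu) (_ : z *m invmx N = 0) ?mul0mx //.
  apply: inj => i; rewrite mulmxKV // /z mulmxBl -mulmxA NC -scalemxAr -scalemxAl.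
  apply/eqP; rewrite mxE [X in _ + X]mxE subr_eq0 [X in X == _]mxE [X in _ == X]mxE.
  by rewrite -!/(aff _ _) rtE [r i * t j]mulrC -mulrA mulKf.
have pN x y (o : R) : o != 0 -> hpoint x *m N = o *: hpoint y ->
    proj_denom N x = o /\ proj_map N x = y.
  move=> o0 E; have D : proj_denom N x = o.
    by rewrite /proj_denom E mxE mxE /hpoint row_mxEl mxE eqxx mulr1.
  by rewrite /proj_map D E linearZ /= /hpoint row_mxKr scalerA mulVf // scale1r.
have image x : P x -> exists2 o, o != 0 & exists2 y, Q y & hpoint x *m N = o *: hpoint y.
  move=> /order_polytope_hull[w [w0 w1 ->]].
  pose o := \sum_j w j / t j.
  have wt0 j : 0 <= w j / t j by rewrite mulr_ge0 // invr_ge0 ltW.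
  have o0 : o != 0.
    apply/eqP => /eqP; rewrite /o psumr_eq0 // => /allP oz.
    suff /eqP : \sum_j w j = 0 by rewrite w1 oner_eq0.
    rewrite big1 // => j _; have := oz j; rewrite mem_index_enum => /(_ isT)/=.
    by rewrite mulf_eq0 invr_eq0 (negPf (tn0 j)) orbF => /eqP.
  have wo : \sum_j w j / t j / o = 1 by rewrite -mulr_suml mulfV.
  have op : 0 <= o by apply: sumr_ge0.
  exists o => //; exists (\sum_j (w j / t j / o) *: q j).
    by apply: polytope_comb => // j; rewrite mulr_ge0 // invr_ge0.
  rewrite !hpoint_comb // mulmx_suml scaler_sumr; apply: eq_bigr => j _.
  by rewrite -scalemxAl vN !scalerA [o * _]mulrC divfK.
exists N => //; split=> [x /image[o o0 [y _ /(pN _ _ _ o0)[-> _]]] //|].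
apply/boolp.predeqP => y; split=> [Qy|[x /image[o o0 [y' Qy' /(pN _ _ _ o0)[_ E]]]]]; last first.
  by rewrite E => <-.
(* For surjectivity y is pulled back: the c i are nonnegative at y, so N c_i = r_i h_i, with h_i =
   [hasse_form i], puts z in the cone over the polytope, where a vanishing first coordinate would
   force z = 0. *)
pose z : 'rV[R]_(1 + d) := hpoint y *m invmx N.
have zN : z *m N = hpoint y by rewrite mulmxKV.
have zc a b : edge [set: X] a b -> 0 <= (z *m facet_form a b) 0 0.
  move=> e; have abE : (a, b) \in hasse X by rewrite inE.
  pose i := enum_rank_in abE (a, b).
  have := cQ i _ Qy; rewrite /aff -zN -mulmxA NC -scalemxAr mxE pmulr_rge0 //.
  by rewrite /hasse_form enum_rankK_in.
have z0 := facet_cone0 zc; have zk := facet_cone zc.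
have zn0 : z 0 (lshift d 0) != 0.
  apply/eqP => E; have zz : z = 0.
    apply/rowP=> k; rewrite [RHS]mxE; case: (splitP k) => k' kk'.
      have -> : k = lshift d k' by apply: val_inj.
      by rewrite ord1.
    have -> : k = rshift 1 k' by apply: val_inj.
    by have := zk k'; rewrite E => /andP[h3 h4]; apply/eqP; rewrite eq_le h3 h4.
  have := congr1 (fun u : 'rV_(1 + d) => u 0 (lshift d 0)) zN.
  rewrite zz mul0mx mxE /hpoint row_mxEl mxE eqxx => /eqP.
  by rewrite eq_sym oner_eq0.
set o := z 0 (lshift d 0) in z0 zn0.
pose x := o^-1 *: rsubmx z.
have xz : hpoint x = o^-1 *: z.
  apply/rowP=> k; case: (splitP k) => k' kk'.
    have -> : k = lshift d k' by apply: val_inj.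
    by rewrite /hpoint row_mxEl mxE !ord1 mxE mulVf.
  have -> : k = rshift 1 k' by apply: val_inj.
  by rewrite /hpoint row_mxEr !mxE.
exists x.
  apply/order_polytopeP => a b e.
  by rewrite /aff xz -scalemxAl mxE mulr_ge0 ?invr_ge0 // zc.
by have [] := pN x y o^-1 (invr_neq0 zn0); rewrite ?xz -?scalemxAl ?zN.
Qed.

End ProjectiveUniqueness.

Lemma antichain_width2 {disp : Order.disp_t} {X : finPOrderType disp} :
  ~ (exists A : {set X}, antichain A /\ #|A| = 3%N) ->
  forall x y z : X, (x >< y)%O -> (y >< z)%O -> (x >< z)%O -> False.
Proof.
move=> hw x y z xy yz xz; apply: hw; exists [set x; y; z].
have nc (u v : X) : (u >< v)%O -> [/\ (u <= v)%O = false, (v <= u)%O = false & u != v].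
  move=> uv; split; first by apply: incomparable_leF.
    by apply: incomparable_leF; rewrite comparable_sym.
  by apply: contraTneq uv => ->; rewrite comparablexx.
have [[xy1 xy2 xy3] [yz1 yz2 yz3] [xz1 xz2 xz3]] := And3 (nc _ _ xy) (nc _ _ yz) (nc _ _ xz).
split; last by rewrite -setUA cardsU1 cards2 !inE negb_or xy3 xz3 yz3.
move=> u v; rewrite !inE -!orbA.
by case/or3P=> /eqP->; case/or3P=> /eqP->; rewrite ?(xy1, xy2, yz1, yz2, xz1, xz2).
Qed.

Local Close Scope ring_scope.

Theorem theorem5p4 (R : realType) (disp : Order.disp_t)
    (X : finPOrderType disp)
    (hranked : ranked X)
    (hwidth : ~ (exists A : {set X}, antichain A /\ #|A| = 3)) :
  graphic (order_polytope R X) /\ projectively_unique (order_polytope R X).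
Proof.
have w2 := antichain_width2 hwidth.
split; last exact: order_polytope_projectively_unique.
exists #|hasse X|, #|filters X|, hasse_form, filter_vertex.
split; first exact: order_polytope_facets_vertices.
apply/boolp.predeqP => p; split; last by apply: cycle_sub_slack => //; exact: slack_matrixE.
apply: slack_sub_cycle; last exact: slack_minors.
by move=> i j; rewrite slack_matrixE; case: (cuts _ _ _); rewrite ?oner_eq0 ?eqxx.
Qed.
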